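(* For every non-negative half-integer $m\in\{0,\tfrac12,1,\tfrac32,\dots\}$, the character of the irreducible representation $L(1,m^2)$ of the Virasoro algebra is $$\mathrm{ch}\,L(1,m^2)=(q^{m^2}-q^{(m+1)^2})\,\varphi(q),\qquad \varphi(q)=\prod_{n\ge1}(1-q^n)^{-1}.$$
   Context: The Virasoro algebra has basis $L_n$ ($n\in\mathbb Z$) and a central element $C$, with $[L_m,L_n]=(m-n)L_{m+n}+\delta_{m+n,0}\frac{m^3-m}{12}C$. $M(c,h)$ is the Verma module, generated by a vector $v$ with $L_nv=0$ ($n>0$), $L_0v=hv$, $C=c$, and $L(c,h)$ is its unique irreducible quotient. The character of a representation $\mathcal H=\bigoplus_{n\ge0}\mathcal H(n)$, where $L_0$ acts as $h+n$ on the finite-dimensional space $\mathcal H(n)$, is $\mathrm{ch}\,\mathcal H=q^h\sum_{n\ge0}\dim\mathcal H(n)\,q^n$. *)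

(* Defs.v *)
From HB Require Import structures.
From mathcomp Require Import all_boot all_order all_algebra.
From mathcomp Require Import generic_quotient ring_quotient.
From mathcomp Require Import finmap monalg.
From mathcomp Require Import boolp classical_sets functions cardinality fsbigop.

Set Implicit Arguments.
Unset Strict Implicit.
Unset Printing Implicit Defensive.

Import GRing.Theory.
Local Open Scope ring_scope.
Local Open Scope classical_set_scope.
Local Open Scope quotient_scope.

(* A representation of the Virasoro algebra is given by the operators of its
   basis elements [L_n] and [C]; [vir_bracket] is the operator of
   [L_m, L_n] = (m - n) L_{m+n} + delta_{m+n,0} (m^3 - m)/12 C. *)
Definition vir_bracket (K : fieldType) (V : lmodType K)
    (L : int -> V -> V) (C : V -> V) (m n : int) (x : V) : V :=
  (m - n)%:~R *: L (m + n) x +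
  (if m + n == 0 then ((m ^+ 3 - m)%:~R / 12%:R) *: C x else 0).

Record virModule (K : fieldType) := VirModule {
  vir_sort :> lmodType K;
  virL : int -> {linear vir_sort -> vir_sort};
  virC : {linear vir_sort -> vir_sort};
  virLL : forall m n x,
    virL m (virL n x) - virL n (virL m x) = vir_bracket virL virC m n x;
  virLC : forall n x, virC (virL n x) = virL n (virC x) }.

Definition vir_hom (K : fieldType) (M N : virModule K)
    (f : {linear M -> N}) : Prop :=
  (forall n x, f (virL M n x) = virL N n (f x)) /\
  (forall x, f (virC M x) = virC N (f x)).

Definition subspace (K : fieldType) (V : lmodType K) (S : set V) : Prop :=
  S 0 /\ forall (a : K) x y, S x -> S y -> S (a *: x + y).

Definition vir_submodule (K : fieldType) (M : virModule K) (S : set M) : Prop :=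
  [/\ subspace S, forall n x, S x -> S (virL M n x)
    & forall x, S x -> S (virC M x)].

Definition vir_irreducible (K : fieldType) (M : virModule K) : Prop :=
  (exists x : M, x <> 0) /\
  forall S : set M, vir_submodule S -> S = [set 0] \/ S = setT.

Definition vir_quotient (K : fieldType) (M N : virModule K) : Prop :=
  exists2 f : {linear M -> N}, vir_hom f & set_surj setT setT f.

Definition hw_vector (K : fieldType) (M : virModule K) (c h : K) (v : M) :
    Prop :=
  [/\ forall n : int, 0 < n -> virL M n v = 0,
      virL M 0 v = h *: v & virC M v = c *: v].

(* [Some n] stands for [L_n] and [None] for [C]. *)
Definition vir_gen : Type := option int.

(* Underlying space of the free associative algebra on the generators; the
   empty word is its unit, and [wact g] is left multiplication by [g]. *)
Definition words (K : fieldType) : lmodType K := {malg K[seq vir_gen]}.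

Definition wone {K : fieldType} : words K := << 1 *g ([::] : seq vir_gen) >>.

HB.lock Definition wact (K : fieldType) (g : vir_gen) (x : words K) : words K :=
  \sum_(w <- msupp (x : {malg K[seq vir_gen]})) << x@_w *g (g :: w) >>.

Section Verma.
Context {K : fieldType}.
Local Notation words := (words K).
Local Notation wact := (@wact K).

Lemma wactE g (x : words) (d : {fset seq vir_gen}) :
  (msupp (x : {malg K[seq vir_gen]}) `<=` d)%fset ->
  wact g x = \sum_(w <- d) << x@_w *g (g :: w) >>.
Proof.
move=> le_xd; rewrite wact.unlock; apply: (big_fset_incl _ le_xd) => w _ wx.
by rewrite (mcoeff_outdom wx) monalgU0.
Qed.

Lemma wactU g a w : wact g << a *g w >> = << a *g (g :: w) >>.
Proof.
apply: etrans (wactE g (d := [fset w]%fset) msuppU_le) _.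
by rewrite big_seq_fset1 mcoeffUU.
Qed.

Lemma wact_linear g : linear (wact g).
Proof.
move=> a x y.
pose d := (msupp (x : {malg K[seq vir_gen]}) `|`
           msupp (y : {malg K[seq vir_gen]}) `|`
           msupp (a *: x + y : {malg K[seq vir_gen]}))%fset.
rewrite (@wactE g x d) ?(@wactE g y d) ?(@wactE g _ d);
  [|by apply/fsubsetP=> w; rewrite !in_fsetU => ->; rewrite ?orbT..].
rewrite scaler_sumr -big_split /=; apply: eq_bigr => w _.
apply/malgP => k; rewrite !(mcoeffD, mcoeffZ, mcoeffU).
by rewrite mulrnDl mulrnAr.
Qed.

HB.instance Definition _ g :=
  GRing.isLinear.Build K words words *:%R (wact g) (wact_linear g).

(* The left ideal by which the free algebra is divided to get the Verma module
   M(c,h) = U(Vir) (x)_{U(b)} K_{c,h}, where b is spanned by C and the L_n with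
   n >= 0. It contains the defining relations of U(Vir),
   multiplied by anything on either side, and the relations
   [L_n = 0 (n > 0)], [L_0 = h], [C = c], multiplied by anything on the left. *)
Inductive verma_rel (c h : K) : words -> Prop :=
| verma_rel0 : verma_rel c h 0
| verma_relD a x y :
    verma_rel c h x -> verma_rel c h y -> verma_rel c h (a *: x + y)
| verma_rel_act g x : verma_rel c h x -> verma_rel c h (wact g x)
| verma_rel_LL m n x :
    verma_rel c h (wact (Some m) (wact (Some n) x)
                   - wact (Some n) (wact (Some m) x)
                   - vir_bracket (fun k => wact (Some k)) (wact None) m n x)
| verma_rel_LC n x :
    verma_rel c h (wact None (wact (Some n) x) - wact (Some n) (wact None x))
| verma_rel_pos (n : int) : 0 < n -> verma_rel c h (wact (Some n) wone)
| verma_rel_L0 : verma_rel c h (wact (Some 0) wone - h *: wone)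
| verma_rel_C : verma_rel c h (wact None wone - c *: wone).

Section Quotient.
Variables c h : K.

Definition verma_pred : {pred words} := fun x => `[< verma_rel c h x >].

Lemma verma_predP x : reflect (verma_rel c h x) (x \in verma_pred).
Proof. exact: asboolP. Qed.

Lemma verma_pred_zmod_closed : zmod_closed verma_pred.
Proof.
split=> [|x y]; first exact/verma_predP/verma_rel0.
move=> /verma_predP rx /verma_predP ry; apply/verma_predP.
by rewrite addrC -scaleN1r; apply: verma_relD.
Qed.

HB.instance Definition _ :=
  GRing.isZmodClosed.Build words verma_pred verma_pred_zmod_closed.

Definition verma_space : Type := Quotient.quot verma_pred.
HB.instance Definition _ := GRing.Zmodule.on verma_space.

Definition verma_pi (x : words) : verma_space := \pi_(Quotient.quot verma_pred) x.

Lemma verma_piP x y : verma_pi x = verma_pi y <-> verma_rel c h (x - y).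
Proof.
split=> [/eqP|r]; first by rewrite /verma_pi -Quotient.idealrBE => /verma_predP.
by apply/eqP; rewrite /verma_pi -Quotient.idealrBE; apply/verma_predP.
Qed.

Lemma verma_reprK u : verma_pi (repr (u : Quotient.quot verma_pred)) = u.
Proof. exact: reprK. Qed.

Lemma verma_piD x y : verma_pi (x + y) = verma_pi x + verma_pi y.
Proof. by rewrite /verma_pi !piE. Qed.

Definition verma_scale (a : K) (u : verma_space) : verma_space :=
  verma_pi (a *: repr (u : Quotient.quot verma_pred)).

Lemma verma_relZ a x : verma_rel c h x -> verma_rel c h (a *: x).
Proof.
by move=> rx; rewrite -[_ *: x]addr0; apply: verma_relD => //; apply: verma_rel0.
Qed.

Lemma verma_scale_pi a x : verma_scale a (verma_pi x) = verma_pi (a *: x).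
Proof.
apply/verma_piP; rewrite -scalerBr; apply: verma_relZ.
by apply/verma_piP; rewrite verma_reprK.
Qed.

Lemma verma_scaleA a b u :
  verma_scale a (verma_scale b u) = verma_scale (a * b) u.
Proof. by rewrite -[u]verma_reprK !verma_scale_pi scalerA. Qed.

Lemma verma_scale1 : left_id 1 verma_scale.
Proof. by move=> u; rewrite -[u]verma_reprK verma_scale_pi scale1r. Qed.

Lemma verma_scaleDr : right_distributive verma_scale +%R.
Proof.
move=> a u w; rewrite -[u]verma_reprK -[w]verma_reprK -verma_piD.
by rewrite !verma_scale_pi -verma_piD scalerDr.
Qed.

Lemma verma_scaleDl u : {morph verma_scale^~ u : a b / a + b}.
Proof.
move=> a b; rewrite -[u]verma_reprK !verma_scale_pi -verma_piD.
by rewrite scalerDl.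
Qed.

HB.instance Definition _ := GRing.Zmodule_isLmodule.Build K verma_space
  verma_scaleA verma_scale1 verma_scaleDr verma_scaleDl.

Lemma verma_pi_linear : linear verma_pi.
Proof. by move=> a x y; rewrite verma_piD -verma_scale_pi. Qed.

HB.instance Definition _ :=
  GRing.isLinear.Build K words verma_space *:%R verma_pi verma_pi_linear.

Definition verma_act (g : vir_gen) (u : verma_space) : verma_space :=
  verma_pi (wact g (repr (u : Quotient.quot verma_pred))).

Lemma verma_act_pi g x : verma_act g (verma_pi x) = verma_pi (wact g x).
Proof.
apply/verma_piP; rewrite -linearB; apply: verma_rel_act.
by apply/verma_piP; rewrite verma_reprK.
Qed.

Lemma verma_act_linear g : linear (verma_act g).
Proof.
move=> a u w; rewrite -[u]verma_reprK -[w]verma_reprK -linearP.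
by rewrite !verma_act_pi !linearP.
Qed.

HB.instance Definition _ g := GRing.isLinear.Build K verma_space verma_space
  *:%R (verma_act g) (verma_act_linear g).

Lemma verma_LL m n u :
  verma_act (Some m) (verma_act (Some n) u) -
    verma_act (Some n) (verma_act (Some m) u) =
  vir_bracket (fun k => verma_act (Some k)) (verma_act None) m n u.
Proof.
rewrite -[u]verma_reprK /vir_bracket !verma_act_pi -linearB -linearZ /=.
set x := repr _.
have -> : (if m + n == 0
           then ((m ^+ 3 - m)%:~R / 12%:R) *: verma_pi (wact None x) else 0) =
          verma_pi (if m + n == 0
           then ((m ^+ 3 - m)%:~R / 12%:R) *: wact None x else 0).
  by case: ifP => _; rewrite ?linear0 ?linearZ.
rewrite -linearD; apply/verma_piP; exact: verma_rel_LL.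
Qed.

Lemma verma_LC n u :
  verma_act None (verma_act (Some n) u) = verma_act (Some n) (verma_act None u).
Proof.
rewrite -[u]verma_reprK !verma_act_pi; apply/verma_piP; exact: verma_rel_LC.
Qed.

End Quotient.
End Verma.

Definition verma (K : fieldType) (c h : K) : virModule K :=
  @VirModule K (verma_space c h) (fun n => verma_act (Some n)) (verma_act None)
    (@verma_LL K c h) (@verma_LC K c h).

Definition verma_v (K : fieldType) (c h : K) : verma c h := verma_pi c h wone.

Lemma verma_v_hw (K : fieldType) (c h : K) : hw_vector c h (verma_v c h).
Proof.
split=> [n n0||]; rewrite /= /verma_v verma_act_pi.
- by rewrite -[RHS](linear0 (verma_pi c h)); apply/verma_piP;
    rewrite subr0; apply: verma_rel_pos.
- by rewrite -linearZ; apply/verma_piP; apply: verma_rel_L0.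
- by rewrite -linearZ; apply/verma_piP; apply: verma_rel_C.
Qed.

Lemma verma_generated (K : fieldType) (c h : K) (S : set (verma c h)) :
  vir_submodule S -> S (verma_v c h) -> S = setT.
Proof.
move=> [[S0 SD] SL SC] Sv; apply/seteqP; split=> // u _.
rewrite -[u]verma_reprK; move: (repr _) => x.
rewrite [x in verma_pi _ _ x](monalgE (x : {malg K[seq vir_gen]})) linear_sum /=.
elim/big_ind: _ => [||w _]; first exact: S0.
  by move=> y z Sy Sz; rewrite -[y]scale1r; apply: SD.
have -> : << (x : {malg K[seq vir_gen]})@_w *g w >> =
          x@_w *: (<< 1 *g w >> : words K).
  by apply/malgP => k; rewrite mcoeffZ !mcoeffU mulrnAr mulr1.
rewrite linearZ -[X in S X]addr0; apply: SD => //.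
elim: w => [|g w IHw]; first exact: Sv.
rewrite -wactU.
by rewrite /= -verma_act_pi; case: g => [n|]; [apply: SL|apply: SC].
Qed.

Section Universal.
Context {K : fieldType} (N : virModule K).

Definition gen_act (g : vir_gen) (y : N) : N :=
  if g is Some n then virL N n y else virC N y.

Definition words_ev (y : N) (x : words K) : N :=
  \sum_(w <- msupp (x : {malg K[seq vir_gen]})) x@_w *: foldr gen_act y w.

Lemma words_evE y (x : words K) (d : {fset seq vir_gen}) :
  (msupp (x : {malg K[seq vir_gen]}) `<=` d)%fset ->
  words_ev y x = \sum_(w <- d) x@_w *: foldr gen_act y w.
Proof.
move=> le_xd; rewrite /words_ev; apply: (big_fset_incl _ le_xd) => w _ wx.
by rewrite (mcoeff_outdom wx) scale0r.
Qed.

Lemma words_ev_linear y : linear (words_ev y).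
Proof.
move=> a x z.
pose d := (msupp (x : {malg K[seq vir_gen]}) `|`
           msupp (z : {malg K[seq vir_gen]}) `|`
           msupp (a *: x + z : {malg K[seq vir_gen]}))%fset.
rewrite (@words_evE y x d) ?(@words_evE y z d) ?(@words_evE y _ d);
  [|by apply/fsubsetP=> w; rewrite !in_fsetU => ->; rewrite ?orbT..].
rewrite scaler_sumr -big_split /=; apply: eq_bigr => w _.
by rewrite mcoeffD mcoeffZ scalerDl scalerA.
Qed.

HB.instance Definition _ y := GRing.isLinear.Build K (words K) N *:%R
  (words_ev y) (words_ev_linear y).

Lemma words_evD y x z : words_ev y (x + z) = words_ev y x + words_ev y z.
Proof. exact: linearD. Qed.

Lemma words_evB y x z : words_ev y (x - z) = words_ev y x - words_ev y z.
Proof. exact: linearB. Qed.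

Lemma words_evZ y a x : words_ev y (a *: x) = a *: words_ev y x.
Proof. exact: linearZ. Qed.

Lemma words_ev1 y : words_ev y wone = y.
Proof.
by rewrite (@words_evE y _ [fset [::]]%fset) ?msuppU_le // big_seq_fset1
  mcoeffUU scale1r.
Qed.

Lemma gen_act_linear g : linear (gen_act g).
Proof. by case: g => [n|] a x y /=; rewrite linearP. Qed.

HB.instance Definition _ g := GRing.isLinear.Build K N N *:%R
  (gen_act g) (gen_act_linear g).

Lemma words_ev_act y g x : words_ev y (wact g x) = gen_act g (words_ev y x).
Proof.
rewrite wact.unlock linear_sum /= {2}/words_ev linear_sum /=.
apply: eq_bigr => w _.
rewrite (@words_evE y _ [fset (g :: w)]%fset) ?msuppU_le // big_seq_fset1.
by rewrite mcoeffUU linearZ.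
Qed.

Lemma words_ev_rel c h y x :
  hw_vector c h y -> verma_rel c h x -> words_ev y x = 0.
Proof.
move=> [ypos y0 yC]; elim=> {x} [|a x z _ IHx _ IHz|g x _ IHx|m n x|n x|n n0||].
- exact: linear0.
- by rewrite linearP /= IHx IHz scaler0 addr0.
- by rewrite words_ev_act IHx linear0.
- rewrite 2!words_evB (words_ev_act _ (Some m) (wact _ _)).
  rewrite (words_ev_act _ (Some n) (wact _ _)) 2!words_ev_act [X in X - _]virLL.
  apply/eqP; rewrite subr_eq0 /vir_bracket words_evD words_evZ.
  rewrite (words_ev_act _ (Some (m + n))); case: ifP => mn0.
    by rewrite words_evZ (words_ev_act _ None).
  by rewrite (linear0 (words_ev y)).
- by rewrite words_evB !words_ev_act /= virLC subrr.
- by rewrite words_ev_act words_ev1 /= ypos.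
- by rewrite words_evB words_evZ words_ev_act words_ev1 /= y0 subrr.
- by rewrite words_evB words_evZ words_ev_act words_ev1 /= yC subrr.
Qed.

Lemma verma_universal (c h : K) (y : N) : hw_vector c h y ->
  exists2 f : {linear verma c h -> N}, vir_hom f & f (verma_v c h) = y.
Proof.
move=> hy.
pose f (u : verma c h) : N := words_ev y (repr (u : Quotient.quot (verma_pred c h))).
have f_pi x : f (verma_pi c h x) = words_ev y x.
  apply/eqP; rewrite -subr_eq0 /f -linearB; apply/eqP/(words_ev_rel hy).
  by apply/verma_piP; rewrite verma_reprK.
have f_lin : linear f.
  move=> a u w; rewrite -[u]verma_reprK -[w]verma_reprK -[a *: _ + _]linearP.
  by rewrite !f_pi linearP.
pose F : {linear verma c h -> N} :=
  HB.pack f (GRing.isLinear.Build K (verma c h) N *:%R f f_lin).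
exists F; last by rewrite /= f_pi words_ev1.
by split=> [n u|u] /=; rewrite -[u]verma_reprK verma_act_pi !f_pi words_ev_act.
Qed.

End Universal.

(* The irreducible quotient [L(c,h)] of [M(c,h)] is unique up to isomorphism. *)
Definition is_irr_verma_quotient (K : fieldType) (c h : K) (L : virModule K) :
    Prop :=
  vir_irreducible L /\ vir_quotient (verma c h) L.

(* Formal power series in [q] with integer coefficients. *)
Definition ps_one (n : nat) : int := (n == 0%N)%:R.

Definition ps_mul (f g : nat -> int) (n : nat) : int :=
  \sum_(i < n.+1) f i * g (n - i)%N.

(* [(1 - q^k)^-1 = \sum_j q^(k j)] *)
Definition ps_geom (k n : nat) : int := (k %| n)%N%:R.

Lemma sum_delta n k (g : nat -> int) :
  \sum_(i < n.+1) ((i : nat) == k)%:R * g i = if (k <= n)%N then g k else 0.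
Proof.
case: leqP => [kn|nk].
  have kn1 : (k < n.+1)%N by rewrite ltnS.
  rewrite (bigD1 (Ordinal kn1)) //= eqxx mul1r big1 ?addr0 // => i ik.
  by rewrite (negbTE (_ : (i : nat) != k)) ?mul0r.
rewrite big1 // => i _; rewrite (_ : (i : nat) == k = false) ?mul0r //.
by apply/negbTE; rewrite neq_ltn (leq_trans (ltn_ord i) nk).
Qed.

Lemma ps_geomV k : (0 < k)%N ->
  ps_mul (fun n => (n == 0%N)%:R - (n == k)%:R) (ps_geom k) = ps_one.
Proof.
move=> k0; apply/funext => n; rewrite /ps_mul.
under eq_bigr => i _ do rewrite mulrBl.
rewrite sumrB !(sum_delta n _ (fun i => ps_geom k (n - i))) leq0n subn0.
rewrite /ps_geom /ps_one; case: leqP => [kn|nk].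
  rewrite dvdn_subl ?dvdnn // subrr.
  by rewrite eqn0Ngt (leq_trans k0 kn).
rewrite subr0; case: (posnP n) => [->|n0]; first by rewrite dvdn0.
by rewrite gtnNdvd // -lt0n n0.
Qed.

(* The coefficient of [q^n] is the same in all the partial products
   [\prod_(1 <= k <= N) (1 - q^k)^-1] with [n <= N], see [ps_phi_limit]. *)
Definition ps_phi (n : nat) : int :=
  (\big[ps_mul/ps_one]_(1 <= k < n.+1) ps_geom k) n.

Lemma ps_mul_geom_low k (f : nat -> int) n : (n < k)%N ->
  ps_mul (ps_geom k) f n = f n.
Proof.
move=> nk; rewrite -[n in RHS]subn0; have /= <- := sum_delta n 0 (fun i => f (n - i)%N).
apply: eq_bigr => i _; congr (_%:R * _); congr nat_of_bool.
case: (posnP i) => [->|i0]; first by rewrite dvdn0.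
by rewrite gtnNdvd ?eqn0Ngt ?i0 // (leq_ltn_trans _ nk) // -ltnS.
Qed.

Lemma ps_phi_limit n N : (n <= N)%N ->
  (\big[ps_mul/ps_one]_(1 <= k < N.+1) ps_geom k) n = ps_phi n.
Proof.
move=> nN; rewrite /ps_phi /index_iota !subn1 /= -(subnKC nN) iotaD.
set r1 := iota 1 n; set r2 := iota _ _.
have r2n k : k \in r2 -> (n < k)%N by rewrite mem_iota add1n => /andP[].
suff: forall j, (j <= n)%N ->
    (\big[ps_mul/ps_one]_(k <- r1 ++ r2) ps_geom k) j =
    (\big[ps_mul/ps_one]_(k <- r1) ps_geom k) j by apply.
elim: r1 => [|k r1 IHr1] /= j jn; last first.
  rewrite !big_cons; apply: eq_bigr => i _.
  by rewrite IHr1 // (leq_trans (leq_subr _ _)).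
rewrite [X in _ = X j]big_nil; elim: r2 r2n => [|k r2 IHr2] r2n; first by rewrite big_nil.
rewrite big_cons ps_mul_geom_low ?IHr2 //.
  by move=> k' k'r2; apply: r2n; rewrite in_cons k'r2 orbT.
by apply: leq_ltn_trans jn _; apply: r2n; rewrite mem_head.
Qed.

(* Formal series [\sum_t a_t q^t] with exponents [t] in [K], represented by
   [t |-> a_t]. The sum in [qmul] is meaningful when it has finitely many
   nonzero terms, for instance when [f] has finite support. *)
Section QSeries.
Context {K : fieldType}.

Definition qpow (a : K) : K -> int := fun t => (t == a)%:R.

Definition qmul (f g : K -> int) : K -> int :=
  fun t => \sum_(s \in [set: K]) f s * g (t - s).

Definition qseries (f : nat -> int) : K -> int :=
  fun t => \sum_(n \in [set n : nat | n%:R = t]) f n.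

Lemma qpowM a g t : qmul (qpow a) g t = g (t - a).
Proof.
rewrite /qmul -(@fsbig_widen _ _ _ _ [set a]) //.
  by rewrite fsbig_set1 /qpow eqxx mul1r.
by move=> s [_ /= sa]; rewrite /qpow; case: eqP => // _; rewrite mul0r.
Qed.

Lemma qpowBM a b g t : qmul (qpow a - qpow b) g t = g (t - a) - g (t - b).
Proof.
have widen c : [set c] `<=` [set a; b] ->
    \sum_(s \in [set a; b]) qpow c s * g (t - s) = g (t - c).
  move=> cab; rewrite -(fsbig_widen _ _ _ cab) ?fsbig_set1 /qpow ?eqxx ?mul1r //.
  by move=> s [_ /= sc]; case: eqP => // _; rewrite mul0r.
rewrite -!widen; [|by move=> s ->; right|by move=> s ->; left].
have fab : finite_set [set a; b] by rewrite finite_setU; split.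
rewrite /qmul -(@fsbig_widen _ _ _ _ [set a; b]) //; last first.
  move=> s [_ /= sab]; have [sa sb] : s <> a /\ s <> b.
    by split=> sE; apply: sab; [left|right].
  by rewrite !fctE /qpow; do 2![case: eqP => //] => _ _; rewrite subrr mul0r.
rewrite !fsbig_finite //= -sumrB; apply: eq_bigr => s _.
by rewrite !fctE mulrBl.
Qed.

Lemma qseriesE f n : [pchar K] =i pred0 -> qseries f n%:R = f n.
Proof.
move=> K0; rewrite /qseries (_ : [set m : nat | m%:R = n%:R] = [set n]).
  by rewrite fsbig_set1.
have natK0 := (pcharf0P K).1 K0; apply/seteqP; split=> [m /= /eqP|m -> //].
have [mn|/ltnW nm] := leqP m n.
  by rewrite eq_sym -subr_eq0 -natrB // natK0 subn_eq0 => nm; apply/eqP; rewrite eqn_leq mn.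
by rewrite -subr_eq0 -natrB // natK0 subn_eq0 => mn; apply/eqP; rewrite eqn_leq mn.
Qed.

End QSeries.

(* For a module without the grading below, or with an infinite-dimensional
   graded piece, [has_character] is false. *)
Section Character.
Context {K : fieldType}.

Definition has_dim (V : lmodType K) (S : set V) (d : nat) : Prop :=
  exists e : 'I_d -> V,
    (forall a : 'I_d -> K, \sum_i a i *: e i = 0 -> forall i, a i = 0) /\
    S = [set x | exists a : 'I_d -> K, x = \sum_i a i *: e i].

Definition direct_sum (V : lmodType K) (H : nat -> set V) : Prop :=
  [/\ forall n, subspace (H n),
      forall x, exists N (y : nat -> V),
        (forall n, H n (y n)) /\ x = \sum_(n < N) y n
    & forall N (y : nat -> V), (forall n, H n (y n)) ->
        \sum_(n < N) y n = 0 -> forall n, (n < N)%N -> y n = 0].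

Definition has_character (M : virModule K) (f : K -> int) : Prop :=
  exists (h : K) (H : nat -> set M) (d : nat -> nat),
  [/\ direct_sum H,
      forall n x, H n x -> virL M 0 x = (h + n%:R) *: x,
      forall n, has_dim (H n) (d n)
    & f = qmul (qpow h) (qseries (fun n => (d n)%:Z))].

End Character.

(* Main.v *)
(** Let the Virasoro algebra act on the Fock space F_t by Sugawara operators
    with c = 1, h = t^2/4.  For k >= 0 the zero mode e of the vertex operator
    F_k -> F_(k+2) commutes with this action; together with the opposite zero
    mode f it satisfies the sl_2 relations, so that every e^s is surjective and
    dim (ker e)(n) = p(n) - p(n-k-1).  The main point is that the words
    L_(-lambda) vac span ker e.  With the charge t as a variable, the
    determinant of the coordinates of these words in degree n is a polynomial
    in t of degree sum_lambda length(lambda) = sum_(r,s >= 1) p(n - rs).  At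
    t = k + eps the coefficient of eps^s lies in ker e^(s+1), which forces the
    order of vanishing at t = k, and by symmetry at t = -k, to be at least
    sum_(s>=0) p(n - (s+1)(s+1+k)).  Over all k these orders add up to the
    degree, so all the inequalities are equalities, in particular the rank at
    t = k is dim (ker e)(n).  Finally e and f are adjoint for the contravariant
    form, which is therefore nondegenerate on ker e; hence ker e is irreducible
    and isomorphic to L(1, k^2/4). *)
From HB Require Import structures.
Require Import Defs.
From mathcomp Require Import all_boot all_order all_algebra.
From mathcomp Require Import perm finmap monalg.
From mathcomp Require Import boolp classical_sets fsbigop functions reals complex.
From mathcomp Require Import ring zify.

Set Implicit Arguments.
Unset Strict Implicit.
Unset Printing Implicit Defensive.

Import Order.TTheory GRing.Theory Num.Theory.
Local Open Scope ring_scope.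

(** * Fock space *)

(** The counts match because a product r r' belongs to the charge r' - r: the term p(n - r r') of
    the degree is met at t = k = r' - r, with s + 1 = r, if r <= r', and at t = -k with k = r - r'
    and s + 1 = r' if r > r'; k = 0 is met once. The power of e grows with that of eps since L_(-i)
    at charge k + eps is L_(-i) + (eps/2) p_i. Here L_(-i) commutes with e, and the commutator of
    p_i with e is a multiple of another mode of the same vertex operator, which again commutes with
    e up to a shift of its index. Exact orders of vanishing yield a rank by a refinement: the first
    step ker e of the flag may be replaced by the span of the words at charge k, so a span smaller
    than ker e would force a larger order. Series in z are never formed. An operator is given by its
    value on the vacuum and its rule for multiplication by p_j, and the quadratic relations are
    reduced to vacuum coefficients by [vac_zero]. The 2 in [b_m, b_n] is the squared norm of the
    root of sl_2, so charges are sl_2 weights. *)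

Lemma foldr_perm (A : eqType) (B : Type) (Q : A -> B -> B) (b : B) (s s' : seq A) :
  (forall x y v, Q x (Q y v) = Q y (Q x v)) -> perm_eq s s' ->
  foldr Q b s = foldr Q b s'.
Proof.
move=> QC.
have key x v t : foldr Q (Q x v) t = Q x (foldr Q v t).
  by elim: t => //= y t ->; rewrite QC.
elim: s s' => [|x s IHs] s' ss'; first by rewrite perm_sym in ss'; rewrite (perm_nilP ss').
have /(nthP x)[i ltis' xE] : x \in s' by rewrite -(perm_mem ss') mem_head.
have s'E : s' = take i s' ++ x :: drop i.+1 s'.
  by rewrite -{1}(cat_take_drop i s') (drop_nth x) // xE.
rewrite s'E foldr_cat /= key -foldr_cat; congr (Q _ _); apply: IHs.
rewrite -(perm_cons x) (perm_trans ss') // {1}s'E.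
by rewrite perm_catC /= perm_cons perm_catC.
Qed.

Lemma perm_rem2 (A : eqType) (x : A) (s s' : seq A) :
  perm_eq s s' -> perm_eq (rem x s) (rem x s').
Proof.
move=> ss'; have [xs|xs] := boolP (x \in s); last by rewrite !rem_id -?(perm_mem ss').
rewrite -(perm_cons x) -(permPl (perm_to_rem xs)) (permPl ss').
by apply: perm_to_rem; rewrite -(perm_mem ss').
Qed.

(* A vector space with a basis indexed by the multisets of natural numbers,
   which are represented by lists. The letter [j] stands for a part of size
   [j.+1]: the basis vectors are the monomials in variables p_1, p_2, ...,
   and the letter [j] is p_(j+1). Working with an abstract such space keeps
   the sums in its elements from being unfolded. *)
Record fockSpace (K : numFieldType) := FockSpace {
  fock_sort :> lmodType K;
  mon : seq nat -> fock_sort;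
  cf : seq nat -> fock_sort -> K;
  lift : forall V : lmodType K, (seq nat -> V) -> fock_sort -> V;
  mon_perm : forall s s', perm_eq s s' -> mon s = mon s';
  cfP : forall s a f g, cf s (a *: f + g) = a * cf s f + cf s g;
  cf_mon : forall s s', cf s (mon s') = (perm_eq s s')%:R;
  cf_inj : forall f, (forall s, cf s f = 0) -> f = 0;
  mon_ind : forall A : fock_sort -> Prop,
    (forall a f g, A f -> A g -> A (a *: f + g)) ->
    (forall s, A (mon s)) -> forall f, A f;
  lift_linear : forall V g, linear (@lift V g);
  lift_mon : forall (V : lmodType K) (g : seq nat -> V) s,
    (forall s s', perm_eq s s' -> g s = g s') -> @lift V g (mon s) = g s }.

Section Coef.
Context {K : numFieldType} {F : fockSpace K}.
Implicit Types f g : F.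

HB.instance Definition _ (V : lmodType K) (g : seq nat -> V) :=
  GRing.isLinear.Build K F V *:%R (lift g) (lift_linear g).

Lemma cf_is_linear s : linear_for *:%R (cf s : F -> K^o).
Proof. exact: cfP. Qed.
HB.instance Definition _ s := GRing.isLinear.Build K F K^o *:%R (cf s : F -> K^o)
  (cf_is_linear s).

Lemma cf0 s : cf s (0 : F) = 0. Proof. exact: linear0. Qed.
Lemma cfD s f g : cf s (f + g) = cf s f + cf s g. Proof. exact: linearD. Qed.
Lemma cfB s f g : cf s (f - g) = cf s f - cf s g. Proof. exact: linearB. Qed.
Lemma cfN s f : cf s (- f) = - cf s f. Proof. exact: linearN. Qed.
Lemma cfZ s a f : cf s (a *: f) = a * cf s f. Proof. exact: linearZ. Qed.
Lemma cf_sum s I (r : seq I) (A : pred I) (G : I -> F) :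
  cf s (\sum_(i <- r | A i) G i) = \sum_(i <- r | A i) cf s (G i).
Proof. exact: linear_sum. Qed.

Lemma cf_eq f g : (forall s, cf s f = cf s g) -> f = g.
Proof.
move=> fg; apply/eqP; rewrite -subr_eq0; apply/eqP/cf_inj => s.
by rewrite cfB fg subrr.
Qed.

End Coef.

Ltac cf_tac tac := apply: cf_eq => ?;
  rewrite ?(cfD, cfB, cfN, cfZ, cf0);
  tac.
Ltac fring := cf_tac ltac:(ring).
Ltac ffield := cf_tac ltac:(field).

Section Fock.
Context {K : numFieldType} {F : fockSpace K}.
Implicit Types f g : F.

Definition vac : F := mon F [::].

Section Ext.
Context {V : lmodType K}.

Definition ext (Q : nat -> V -> V) (v0 : V) (f : F) : V :=
  lift (fun s => foldr Q v0 s) f.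
HB.instance Definition _ Q v0 := GRing.isLinear.Build K F V *:%R (ext Q v0) (lift_linear _).

Lemma ext_mon (Q : nat -> V -> V) v0 s : (forall i j v, Q i (Q j v) = Q j (Q i v)) ->
  ext Q v0 (mon F s) = foldr Q v0 s.
Proof. by move=> QC; rewrite /ext lift_mon // => t t'; apply: foldr_perm. Qed.

End Ext.

Definition pmul (j : nat) (f : F) : F := lift (fun s => mon F (j :: s)) f.
HB.instance Definition _ j := GRing.isLinear.Build K F F *:%R (pmul j) (lift_linear _).

Lemma pmul_mon j s : pmul j (mon F s) = mon F (j :: s).
Proof. by rewrite /pmul lift_mon // => t t' tt'; apply: mon_perm; rewrite perm_cons. Qed.

Lemma mon_foldr s : mon F s = foldr pmul vac s.
Proof. by elim: s => //= j s <-; rewrite pmul_mon. Qed.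

Lemma fock_ind (A : F -> Prop) : A vac ->
  (forall a f g, A f -> A g -> A (a *: f + g)) ->
  (forall j f, A f -> A (pmul j f)) -> forall f, A f.
Proof.
move=> A1 AD AP; apply: mon_ind => // s.
by rewrite mon_foldr; elim: s => //= j t; apply: AP.
Qed.

Lemma pmulC i j f : pmul i (pmul j f) = pmul j (pmul i f).
Proof.
elim/mon_ind: f => [a f g IHf IHg|s]; first by rewrite !linearP /= IHf IHg.
by rewrite !pmul_mon; apply: mon_perm; apply/seq.permP => q /=; rewrite addnCA.
Qed.

Lemma ext_pmul (V : lmodType K) (Q : nat -> V -> V) v0 :
  (forall j, linear (Q j)) -> (forall i j v, Q i (Q j v) = Q j (Q i v)) ->
  forall j f, ext Q v0 (pmul j f) = Q j (ext Q v0 f).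
Proof.
move=> Ql QC j; elim/mon_ind => [a f g IHf IHg|s]; first by rewrite !linearP /= IHf IHg Ql.
by rewrite pmul_mon !ext_mon.
Qed.

Lemma ext_vac (V : lmodType K) (Q : nat -> V -> V) v0 :
  (forall i j v, Q i (Q j v) = Q j (Q i v)) -> ext Q v0 vac = v0.
Proof. by move=> QC; rewrite /vac ext_mon. Qed.

(* [pder j] is [2 n d/dp_n] with [n = j+1]. *)
Definition pder (j : nat) (f : F) : F :=
  lift (fun s => (2 * j.+1 * count_mem j s)%:R *: mon F (rem j s)) f.
HB.instance Definition _ j := GRing.isLinear.Build K F F *:%R (pder j) (lift_linear _).

Lemma pder_mon j s : pder j (mon F s) = (2 * j.+1 * count_mem j s)%:R *: mon F (rem j s).
Proof.
rewrite /pder lift_mon // => t t' tt'; rewrite (seq.permP tt').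
by congr (_ *: _); apply: mon_perm; exact: perm_rem2.
Qed.

Lemma pder_vac j : pder j vac = 0.
Proof. by rewrite pder_mon muln0 scale0r. Qed.

Lemma pder_pmul i j f : pder i (pmul j f) = pmul j (pder i f) +
  (if i == j then 2 * i.+1 else 0)%:R *: f.
Proof.
elim/mon_ind: f => [a f g IHf IHg|s].
  by rewrite !linearP /= IHf IHg; move: (_%:R) => c; fring.
rewrite pmul_mon !pder_mon linearZ /= pmul_mon (eq_sym j); have [<-|ij] := eqVneq i j;
  last first.
  by rewrite add0n scale0r addr0.
have [si|si] := boolP (i \in s).
  rewrite (mon_perm F (_ : perm_eq (i :: rem i s) s)); last by rewrite perm_sym perm_to_rem.
  by rewrite -scalerDl -natrD; congr (_%:R *: _); rewrite mulnDr muln1 addnC.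
by rewrite (count_memPn si) muln0 scale0r add0r addn0 muln1.
Qed.

Lemma pderC i j f : pder i (pder j f) = pder j (pder i f).
Proof.
elim/fock_ind: f => [|a f g IHf IHg|l f IHf]; first by rewrite !pder_vac !linear0.
  by rewrite !linearP /= IHf IHg.
rewrite pder_pmul linearD linearZ /= (pder_pmul i) IHf pder_pmul linearD linearZ /=
  (pder_pmul j).
by rewrite -!addrA; congr (_ + _); rewrite addrC.
Qed.

Lemma cf_pder j s f : cf s (pder j f) = (2 * j.+1 * (count_mem j s).+1)%:R * cf (j :: s) f.
Proof.
elim/mon_ind: f => [a f g IHf IHg|t]; first by rewrite linearP /= !cfP IHf IHg; ring.
rewrite pder_mon cfZ !cf_mon.
have [jt|jt] := boolP (j \in t); last first.
  rewrite (count_memPn jt) muln0 mul0r (_ : perm_eq _ _ = false) ?mulr0 //.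
  by apply: contraNF jt => /perm_mem <-; apply: mem_head.
rewrite (permPr (perm_to_rem jt)) perm_cons; case: (boolP (perm_eq _ _)) => [st|];
  last by rewrite !mulr0.
congr (_ * _); congr (_ * _)%:R; rewrite (seq.permP (perm_to_rem jt)) /= eqxx add1n.
by rewrite (seq.permP st).
Qed.

Definition vcf (f : F) : K := cf [::] f.

Lemma vcf_vac : vcf vac = 1.
Proof. by rewrite /vcf cf_mon. Qed.

Lemma vcf_pmul j f : vcf (pmul j f) = 0.
Proof.
rewrite /vcf; elim/mon_ind: f => [a f g IHf IHg|s].
  by rewrite (linearP (pmul j)) /= cfP IHf IHg mulr0 addr0.
by rewrite pmul_mon cf_mon; case: (boolP (perm_eq _ _)) => [/perm_size|].
Qed.

Lemma cf_vac s : cf s vac = (s == [::])%:R.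
Proof.
rewrite cf_mon; case: s => [|j s] //=.
by case: (boolP (perm_eq _ _)) => [/perm_size|].
Qed.

Lemma ker_pder f : (forall j, pder j f = 0) -> f = vcf f *: vac.
Proof.
move=> Df; apply: cf_eq => -[|j s]; rewrite cfZ cf_vac ?mulr1 //= mulr0.
have /eqP := cf_pder j s f; rewrite Df cf0 eq_sym mulf_eq0 pnatr_eq0 => /orP[|/eqP //].
by rewrite !muln_eq0.
Qed.

End Fock.

(** * Virasoro operators *)

Section Virasoro.
Context {K : numFieldType} {F : fockSpace K}.
Implicit Types (f g : F) (t : K) (m n : int).

(* The Heisenberg algebra at charge [t]: [b_m, b_n] = 2 m delta_{m+n,0}. The
   index [Negz j] is -(j+1), so [heis t (Negz j)] is [pmul j]. *)
Definition heis t n f : F :=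
  match n with Posz 0 => t *: f | Posz j.+1 => pder j f | Negz j => pmul j f end.

Lemma heis_linear t n : linear (heis t n).
Proof. by case: n => [[|j]|j] a f g /=; rewrite ?linearP //=; fring. Qed.
HB.instance Definition _ t n := GRing.isLinear.Build K F F *:%R (heis t n) (heis_linear t n).

Lemma heisC t m n f :
  heis t m (heis t n f) = heis t n (heis t m f) + (if m + n == 0 then 2 * m else 0)%:~R *: f.
Proof.
have b0 k g : heis t k (heis t 0 g) = heis t 0 (heis t k g) by rewrite /= linearZ.
have r0 (c : int) g h : c = 0 -> g = g + c%:~R *: h :> F by move=> ->; rewrite scale0r addr0.
have [->|m0] := eqVneq m 0; first by rewrite b0; apply: r0; rewrite mulr0 if_same.
have [->|n0] := eqVneq n 0.
  by rewrite b0; apply: r0; rewrite addr0 (negbTE m0).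
have bD i : heis t (Posz i.+1) = pder i by [].
have bN i : heis t (Negz i) = pmul i by [].
case: m n m0 n0 => [[|i]|i] [[|j]|j] // _ _; rewrite !(bD, bN).
- by rewrite pderC; exact: r0.
- rewrite pder_pmul; congr (_ + _ *: _); have [->|ij] := eqVneq i j.
    by rewrite ifT; [rewrite -pmulrn natrM|lia].
  by rewrite ifF; last lia.
- rewrite pder_pmul -addrA -scalerDl eq_sym; apply/esym;
    rewrite -[RHS]addr0 -[in RHS](scale0r f).
  congr (_ + _ *: _); have [->|ij] := eqVneq i j.
    rewrite ifT; last lia.
    by rewrite NegzE rmorphM /= rmorphN /= -!pmulrn natrM; ring.
  by rewrite ifF ?addr0 //; lia.
- by rewrite pmulC; exact: r0.
Qed.

(* The Sugawara operators L_n = 1/4 sum_i :b_i b_(n-i): at charge [t] are defined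
   by their values on the vacuum and by [L_n, b_(-j)] = j b_(n-j), without
   infinite sums. *)
Definition viropvac t n : F :=
  match n with
  | Posz 0 => (t ^+ 2 / 4%:R) *: vac
  | Posz _ => 0
  | Negz q => (t / 2%:R) *: pmul q vac + (4%:R)^-1 *: \sum_(i < q) pmul i (pmul (q - i.+1) vac)
  end.

(** The rule for L_n (p_j f) involves f as well as L_n f, so the recursion carries the pair (f, L_n
    f). *)
Definition virop_step t n (j : nat) (x : F * F) : F * F :=
  (pmul j x.1, pmul j x.2 + j.+1%:R *: heis t (n + Negz j) x.1).

Definition virop t n f : F := (ext (virop_step t n) (vac, viropvac t n) f).2.

Lemma virop_linear t n : linear (virop t n).
Proof. by move=> a f g; rewrite /virop linearP. Qed.
HB.instance Definition _ t n := GRing.isLinear.Build K F F *:%R (virop t n) (virop_linear t n).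

Lemma heis_pmul t m j f :
  heis t m (pmul j f) = pmul j (heis t m f) + (if m + Negz j == 0 then 2 * m else 0)%:~R *: f.
Proof. exact: (heisC t m (Negz j)). Qed.

Lemma virop_step_linear t n j : linear (virop_step t n j).
Proof.
move=> a [x1 x2] [y1 y2]; by rewrite /virop_step /= !linearP /=; congr pair; fring.
Qed.

(** The steps commute because the central terms, present only for n = i + j + 2, are 2 (i+1) (j+1)
    in either order. *)
Lemma virop_stepC t n i j x : virop_step t n i (virop_step t n j x) =
  virop_step t n j (virop_step t n i x).
Proof.
case: x => x1 x2; rewrite /virop_step /=; congr pair; first by rewrite pmulC.
rewrite !linearD !linearZ /= !heis_pmul pmulC.
have [e|e] := eqVneq (n + Negz i + Negz j) 0.
  rewrite (_ : _ == 0 = true); last lia.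
  have -> : n + Negz i = j.+1 by lia.
  by have -> : n + Negz j = i.+1 by [lia]; fring.
rewrite (_ : _ == 0 = false); last lia.
fring.
Qed.

Lemma virop_vac t n : virop t n vac = viropvac t n.
Proof. by rewrite /virop ext_vac //; exact: virop_stepC. Qed.

Lemma virop_step1 t n f : (ext (virop_step t n) (vac, viropvac t n) f).1 = f.
Proof.
elim/(@fock_ind K F): f => [|a f g IHf IHg|j f IHf]; first by rewrite ext_vac //;
  exact: virop_stepC.
  by rewrite linearP /= IHf IHg.
by rewrite ext_pmul /= ?IHf //; [exact: virop_step_linear|exact: virop_stepC].
Qed.

Lemma virop_pmul t n j f : virop t n (pmul j f) = pmul j (virop t n f) + j.+1%:R *:
  heis t (n + Negz j) f.
Proof.
rewrite /virop ext_pmul; [|exact: virop_step_linear|exact: virop_stepC].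
by rewrite /virop_step /= virop_step1.
Qed.

Lemma pder_sum_pmul i q :
  pder i (\sum_(l < q) pmul l (pmul (q - l.+1) (vac : F))) =
  if (i < q)%N then (2 * (2 * i.+1))%:R *: pmul (q - i.+1) vac else 0.
Proof.
have key (h : nat -> F) : \sum_(l < q) (if i == l then 2 * i.+1 else 0)%:R *: h l =
    if (i < q)%N then (2 * i.+1)%:R *: h i else 0.
  case: ltnP => iq.
    rewrite (bigD1 (Ordinal iq)) //= eqxx big1 ?addr0 // => l.
    by rewrite -val_eqE /= eq_sym => /negbTE ->; rewrite scale0r.
  by rewrite big1 // => l _; rewrite (_ : _ == _ = false) ?scale0r //; have := ltn_ord l; lia.
rewrite linear_sum /=; under eq_bigr => l _ do rewrite pder_pmul pder_pmul pder_vac linear0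
  add0r linearZ /=.
(* The reflection l -> q - 1 - l shows that the second factors contribute as much as the first
   ones. *)
rewrite big_split /= (reindex_inj rev_ord_inj) /=.
under eq_bigr => l _ do rewrite subnSK // subKn ?(ltnW (ltn_ord l)) //.
rewrite (key (fun l => pmul (q - l.+1) vac)); case: ifP => _; last by rewrite addr0.
by rewrite -scalerDl -natrD; congr (_%:R *: _); lia.
Qed.

Lemma pder_viropvac t n i : pder i (viropvac t n) = i.+1%:R *: heis t (Posz i.+1 + n) vac.
Proof.
case: n => [n|q].
  rewrite (_ : Posz i.+1 + Posz n = Posz (i + n).+1) // /heis pder_vac scaler0.
  by case: n => [|n]; rewrite /= ?linear0 // linearZ /= pder_vac scaler0.
rewrite /viropvac linearD !linearZ /= pder_pmul pder_vac linear0 add0r pder_sum_pmul.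
case: (ltngtP i q) => iq.
- rewrite (_ : _ + Negz q = Negz (q - i.+1)); last lia.
  by rewrite /= scale0r scaler0 add0r scalerA; congr (_ *: _); rewrite !natrM; field.
- rewrite (_ : _ + Negz q = Posz (i - q.+1).+1); last lia.
  by rewrite /= pder_vac scale0r !scaler0 addr0.
- rewrite iq (_ : _ + Negz q = 0); last lia.
  by rewrite /= scaler0 addr0 !scalerA natrM; congr (_ *: _); field.
Qed.

Arguments heis : simpl never.

Lemma heis_virop t m n f : heis t m (virop t n f) = virop t n (heis t m f) + m%:~R *:
  heis t (m + n) f.
Proof.
case: m => [[|i]|j].
- by rewrite /heis linearZ /= scale0r addr0.
- elim/(@fock_ind K F): f => [|a f g IHf IHg|j f IHf].
  + by rewrite virop_vac [heis _ _ (viropvac _ _)]pder_viropvac [heis t i.+1 vac]pder_vac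
      linear0 add0r -pmulrn.
  + by rewrite !linearP /= IHf IHg; fring.
  rewrite virop_pmul linearD linearZ /= !heis_pmul heisC IHf.
  rewrite !linearD !linearZ /= virop_pmul (addrA (Posz i.+1)).
  have [e|e] := eqVneq (Posz i.+1 + n + Negz j) 0; last
    (move: ((if _ + Negz j == 0 then _ else _)%:~R) => c; fring).
  have -> : Posz i.+1 + n = j.+1 by lia.
  by rewrite !rmorphM /= -!pmulrn; move: ((if _ then _ else _)%:~R) => c; fring.
- have -> : (Negz j)%:~R = - j.+1%:R :> K by rewrite NegzE rmorphN /= -pmulrn.
  have bN g : heis t (Negz j) g = pmul j g by [].
  by rewrite !bN virop_pmul [Negz j + n]addrC; fring.
Qed.

(** At charge 0 the vacuum has weight 0, so L_0 is the degree operator. *)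
Definition degop f : F := virop 0 0 f.
HB.instance Definition _ := GRing.isLinear.Build K F F *:%R degop (virop_linear 0 0).

Lemma degop_vac : degop vac = 0.
Proof. by rewrite /degop virop_vac /viropvac expr0n mul0r scale0r. Qed.

Lemma degop_heis t n f : degop (heis t n f) = heis t n (degop f) - n%:~R *: heis t n f.
Proof.
have [->|n0] := eqVneq n 0; first by rewrite scale0r subr0 /heis linearZ.
have b0 g : heis t n g = heis 0 n g by case: n n0 => [[|j]|j].
by rewrite !b0 /degop (heis_virop 0 n 0) addr0 addrK.
Qed.

Lemma degop_pmul j f : degop (pmul j f) = pmul j (degop f) + j.+1%:R *: pmul j f.
Proof. by rewrite /degop virop_pmul add0r. Qed.

Lemma degop_mon s : degop (mon F s) = (sumn (map S s))%:R *: mon F s.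
Proof.
elim: s => [|j s IHs]; first by rewrite degop_vac scale0r.
by rewrite -pmul_mon degop_pmul IHs linearZ /= -scalerDl addrC -natrD.
Qed.

Lemma cf_degop s f : cf s (degop f) = (sumn (map S s))%:R * cf s f.
Proof.
elim/mon_ind: f => [a f g IHf IHg|u]; first by rewrite linearP /= !cfP IHf IHg; ring.
rewrite degop_mon cfZ cf_mon; case: (boolP (perm_eq s u)) => [su|]; last by rewrite !mulr0.
by congr (_%:R * _); apply: perm_sumn; rewrite perm_sym perm_map.
Qed.

Lemma degop_lt0 n f : degop f = n%:~R *: f -> n < 0 -> f = 0.
Proof.
move=> df n0; apply: cf_inj => s; have /eqP := cf_degop s f.
rewrite df cfZ -subr_eq0 -mulrBl pmulrn -intrB mulf_eq0 intr_eq0 => /orP[|/eqP //]; lia.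
Qed.

Lemma degop_vcf n f : degop f = n%:~R *: f -> n != 0 -> vcf f = 0.
Proof.
move=> df n0; have /eqP := cf_degop [::] f.
by rewrite df cfZ mul0r mulf_eq0 intr_eq0 (negbTE n0) => /eqP.
Qed.

Lemma degop_eq0 f : degop f = 0 -> f = vcf f *: vac.
Proof.
move=> df; apply: cf_eq => -[|j s]; rewrite cfZ cf_vac ?mulr1 //= mulr0.
by have /eqP := cf_degop (j :: s) f; rewrite df cf0 eq_sym mulf_eq0 pnatr_eq0 => /orP[|/eqP //].
Qed.

Lemma degop_virop t n f : degop (virop t n f) = virop t n (degop f) - n%:~R *: virop t n f.
Proof.
elim/(@fock_ind K F): f => [|a f g IHf IHg|j f IHf].
- rewrite degop_vac linear0 add0r virop_vac; case: n => [[|n]|q] /=.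
  + by rewrite scale0r linearZ /= degop_vac scaler0 oppr0.
  + by rewrite linear0 scaler0 oppr0.
  rewrite NegzE mulrNz scaleNr opprK -pmulrn linearD !linearZ /= degop_pmul degop_vac linear0
    add0r.
  suff -> : degop (\sum_(i < q) pmul i (pmul (q - i.+1) vac)) =
      q.+1%:R *: \sum_(i < q) pmul i (pmul (q - i.+1) (vac : F)) by fring.
  rewrite linear_sum scaler_sumr; apply: eq_bigr => i _ /=.
  rewrite !(degop_pmul, degop_vac, linear0, add0r) linearZ /= -scalerDl -natrD.
  by congr (_%:R *: _); have := ltn_ord i; lia.
- by rewrite !linearP /= IHf IHg; fring.
rewrite virop_pmul linearD linearZ /= degop_heis !degop_pmul IHf !(linearD, linearB, linearZ)
  /= !virop_pmul.
by rewrite NegzE intrD mulrNz -pmulrn; fring.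
Qed.

(* An operator commuting with all [heis n] up to operators of the same family is
   determined by its values on the vacuum, and these have no component of
   positive degree. *)
Lemma vac_zero (I : Type) (T : I -> F -> F) (deg : I -> int) t :
  (forall x, linear (T x)) ->
  (forall x, degop (T x vac) = (deg x)%:~R *: T x vac) ->
  (forall x, deg x = 0 -> vcf (T x vac) = 0) ->
  (forall x n, n != 0 -> exists c1 c2 y1 y2,
    [/\ c1 != 0 -> deg y1 = deg x - n, c2 != 0 -> deg y2 = deg x - n
      & forall f, heis t n (T x f) = T x (heis t n f) + c1 *: T y1 f + c2 *: T y2 f]) ->
  forall x f, T x f = 0.
Proof.
move=> Tl Tdeg T0 Tb.
have Tvac x : T x vac = 0.
  have [|xn] := ltP (deg x) 0; first exact: degop_lt0 (Tdeg _).
  have [m xm] : exists m : nat, (deg x <= m%:Z)%R by exists `|deg x|%N; lia.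
  elim: m x xn xm => [|m IHm] x xn xm.
    have x0 : deg x = 0 by lia.
    have := Tdeg x; rewrite x0 scale0r => /degop_eq0 ->.
    by rewrite T0 ?scale0r.
  have [xm'|{}xm] : deg x <= m%:Z \/ deg x = m.+1 by [lia|].
    exact: IHm.
  rewrite (ker_pder (f := T x vac)) ?(degop_vcf (Tdeg x)) ?scale0r ?xm // => j.
  (* [pder j] sends T_x vac to terms of lower degree, which vanish by induction; for c = 0 nothing
     is known about the degree of y. *)
  have IH c y : (c != 0 -> deg y = deg x - j.+1%:Z) -> c *: T y vac = 0.
    have [->|c0] := eqVneq c 0; first by rewrite scale0r.
    move=> /(_ isT) yE; suff -> : T y vac = 0 by rewrite scaler0.
    have [|y0] := ltP (deg y) 0; first exact: degop_lt0 (Tdeg _).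
    by apply: IHm => //; lia.
  have [//|c1 [c2 [y1 [y2 [y1E y2E /(_ vac)]]]]] := Tb x (Posz j.+1) _.
  rewrite (IH _ _ y1E) (IH _ _ y2E) !addr0 /heis pder_vac => ->.
  by have := Tl x (- 1) 0 0; rewrite scaler0 addr0 scaleN1r addNr.
move=> x f; elim/(@fock_ind K F): f x => [//|a f g IHf IHg x|j f IHf x].
  by rewrite Tl IHf IHg scaler0 addr0.
have [//|c1 [c2 [y1 [y2 [_ _ /(_ f)]]]]] := Tb x (Negz j) _.
by rewrite !IHf !scaler0 !addr0 /heis linear0 => <-.
Qed.

End Virasoro.

Section Virasoro2.
Context {K : numFieldType} {F : fockSpace K}.
Implicit Types (f g : F) (t : K) (m n : int).

(** For m = M + 1 the right-hand side is m^3 - m: this sum produces the central term of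
    [L_m, L_(-m)] on the vacuum, with c = 1. *)
Lemma sum_sqr_triangle M : (6 * \sum_(i < M) (i.+1 * (M - i)) = M * M.+1 * M.+2)%N.
Proof.
have tri N : (2 * \sum_(i < N) i.+1 = N * N.+1)%N.
  by elim: N => [|N IH]; rewrite ?big_ord0 // big_ord_recr /= mulnDr IH; lia.
elim: M => [|M IH]; first by rewrite big_ord0.
have -> : (\sum_(i < M.+1) i.+1 * (M.+1 - i) =
    \sum_(i < M) i.+1 * (M - i) + \sum_(i < M.+1) i.+1)%N.
  rewrite !big_ord_recr /= addnA -big_split /=; congr (_ + _)%N; last by rewrite subSnn muln1.
  by apply: eq_bigr => i _; rewrite subSn ?(ltnW (ltn_ord i)) // mulnS addnC.
by have := tri M.+1; rewrite mulnDr IH; move: (\sum_(i < M.+1) _)%N => S; nia.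
Qed.

Lemma vcf0 : vcf (0 : F) = 0. Proof. exact: cf0. Qed.
Lemma vcfD f g : vcf (f + g) = vcf f + vcf g. Proof. exact: cfD. Qed.
Lemma vcfB f g : vcf (f - g) = vcf f - vcf g. Proof. exact: cfB. Qed.
Lemma vcfN f : vcf (- f) = - vcf f. Proof. exact: cfN. Qed.
Lemma vcfZ a f : vcf (a *: f) = a * vcf f. Proof. exact: cfZ. Qed.
Lemma vcf_sum I (r : seq I) (A : pred I) (G : I -> F) :
  vcf (\sum_(i <- r | A i) G i) = \sum_(i <- r | A i) vcf (G i).
Proof. exact: cf_sum. Qed.
Definition vcfE := (vcf0, vcfD, vcfB, vcfN, vcfZ).

Lemma heis_pmul_vac t i j : heis t (Posz i.+1) (pmul j (vac : F)) =
  (if i == j then 2 * i.+1 else 0)%:R *: vac.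
Proof. by rewrite /heis pder_pmul pder_vac linear0 add0r. Qed.

Lemma vcf_virop_virop_vac t M : vcf (virop t M.+1 (virop t (Negz M) (vac : F))) =
  M.+1%:R * t ^+ 2 / 2%:R + ((M.+1%:Z) ^+ 3 - M.+1%:Z)%:~R / 12%:R.
Proof.
have b0 : heis t 0 (vac : F) = t *: vac by [].
rewrite [virop t (Negz M) _]virop_vac /= linearD !linearZ /= linear_sum /=
  virop_pmul [virop t _ vac]virop_vac /= linear0 add0r.
rewrite (_ : M.+1%:Z + Negz M = 0); last lia.
rewrite b0 !vcfE vcf_vac vcf_sum.
rewrite (eq_bigr (fun i : 'I_M => (2 * (i.+1 * (M - i)))%:R)) => [|i _]; last first.
  have iM := ltn_ord i.
  rewrite virop_pmul vcfD vcf_pmul add0r vcfZ (_ : M.+1%:Z + Negz i = (M - i.+1).+1); last lia.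
  by rewrite heis_pmul_vac eqxx vcfZ vcf_vac mulr1 -natrM subnSK //; congr _%:R; lia.
rewrite -natr_sum -big_distrr /=.
have -> : (M.+1%:Z ^+ 3 - M.+1%:Z)%:~R = (6 * \sum_(i < M) i.+1 * (M - i))%:R :> K.
  by rewrite sum_sqr_triangle pmulrn; congr _%:~R; lia.
move: (\sum_(i < M) _)%N => S; rewrite !natrM; by field.
Qed.

(** Both sides have the same commutators with the nonzero Heisenberg modes, so [vac_zero] applies to
    a family with one member. Its vacuum coefficient matters for m + n = 0 only. *)
Lemma virop_comm t m n f : virop t m (virop t n f) - virop t n (virop t m f) =
  (m - n)%:~R *: virop t (m + n) f + (if m + n == 0 then (m ^+ 3 - m)%:~R / 12%:R else 0) *: f.
Proof.
pose T (_ : unit) f := virop t m (virop t n f) - virop t n (virop t m f) - (m - n)%:~R *: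
  virop t (m + n) f -
  (if m + n == 0 then (m ^+ 3 - m)%:~R / 12%:R else 0) *: f.
apply/eqP; rewrite -subr_eq0 opprD addrA; apply/eqP.
apply: (vac_zero (T := T) (deg := fun _ => - (m + n)) (t := t) _ _ _ _ tt) => {f}.
- move=> u a f g; rewrite /T; move: (if _ then _ else _) => c.
  by rewrite !linearP /=; fring.
- move=> u; rewrite /T !(linearB, linearZ) /= !(degop_virop, linearB, degop_vac, linear0,
    linearZ) /=.
  case: eqVneq => [mn|_]; last by rewrite rmorphN intrD; fring.
  have -> : n = - m by lia.
  by rewrite subrr !rmorphN; fring.
- move=> u /eqP; rewrite oppr_eq0 => /eqP mn; rewrite /T mn eqxx.
  have -> : n = - m by lia.
  rewrite !vcfE vcf_vac (virop_vac t 0) /= vcfZ vcf_vac !mulr1.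
  case: m {mn u T} => [[|M]|M].
  + by rewrite oppr0 expr0n /= !subrr !mulr0z !mul0r !subr0.
  + have -> : - M.+1%:Z = Negz M by lia.
    by rewrite vcf_virop_virop_vac virop_vac /= linear0 vcf0 NegzE opprK intrD -!pmulrn; field.
  + have -> : - Negz M = M.+1 by lia.
    rewrite vcf_virop_virop_vac virop_vac /= linear0 vcf0 NegzE.
    by rewrite !(intrB, rmorphXn, rmorphN) /= -!pmulrn; field.
move=> u k k0; exists 0, 0, tt, tt; split; rewrite ?eqxx // => f.
rewrite /T; move: (if _ then _ else _) => c.
rewrite !(linearB, linearZ) /=. rewrite !heis_virop !linearD !linearZ /=.
rewrite (addrA k m n) (addrAC k n m) !intrD; fring.
Qed.
End Virasoro2.

(** * Vertex operators *)

Section Vertex.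
Context {K : numFieldType} {F : fockSpace K}.
Implicit Types (f g : F) (t : K) (m n : int).

(* [hsym i] is the complete homogeneous symmetric function of degree [i], as a
   polynomial in the power sums p_n. *)
Fixpoint hsyms (i : nat) : seq F :=
  if i is i'.+1 then
    (i%:R^-1 *: \sum_(l < i) pmul l (nth 0 (hsyms i') l)) :: hsyms i'
  else [:: vac].
Definition hsym i : F := head 0 (hsyms i).
Definition hsymz n : F := if n is Posz i then hsym i else 0.

Lemma nth_hsyms i l : (l <= i)%N -> nth 0 (hsyms i) l = hsym (i - l).
Proof.
elim: i l => [|i IHi] [|l] //= li.
by rewrite IHi // subSS.
Qed.

Lemma hsym_rec i : i.+1%:R *: hsym i.+1 = \sum_(l < i.+1) pmul l (hsym (i - l)).
Proof.
rewrite /hsym /= scalerA mulfV ?pnatr_eq0 // scale1r; apply: eq_bigr => l _.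
by rewrite nth_hsyms // -ltnS.
Qed.

Lemma natrZ_inj i f g : i.+1%:R *: f = i.+1%:R *: g -> f = g.
Proof. by apply: scalerI; rewrite pnatr_eq0. Qed.

(** The series sum_i h_i z^i is exp (sum_n p_n z^n / n), which n d/dp_n multiplies by z^n. The
    induction runs through Newton's identity [hsym_rec]. *)
Lemma pder_hsym j i : pder j (hsym i) = 2%:R *: hsymz (i%:Z + Negz j).
Proof.
elim/ltn_ind: i => -[|i] IHi; first by rewrite add0r pder_vac scaler0.
apply: (@natrZ_inj i); rewrite -linearZ /= hsym_rec linear_sum /=.
under eq_bigr => l _ do rewrite pder_pmul IHi ?ltnS ?leq_subr // linearZ.
rewrite big_split /= -scaler_sumr.
have -> : \sum_(l < i.+1) pmul l (hsymz ((i - l)%:Z + Negz j)) =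
    (if (j < i)%N then (i - j)%:R *: hsym (i - j) else 0).
  case: ltnP => ji; last first.
    rewrite big1 // => l _; rewrite (_ : _ + _ = Negz (j - (i - l))) ?linear0 //; lia.
  rewrite -(prednK (n := i - j)) ?subn_gt0 // hsym_rec prednK ?subn_gt0 //.
  rewrite (big_ord_widen i.+1 (fun l => pmul l (hsym ((i - j).-1 - l)))) ?leqW ?leq_subr //.
  rewrite [RHS]big_mkcond /=; apply: eq_bigr => l _; case: ifP => lij.
    by rewrite (_ : _ + _ = Posz ((i - j).-1 - l)) //; lia.
  rewrite (_ : _ + _ = Negz (j - (i - l))) ?linear0 //; have := ltn_ord l; lia.
have -> : \sum_(l < i.+1) (if j == l then 2 * j.+1 else 0)%:R *: hsym (i - l) =
    (if (j <= i)%N then (2 * j.+1)%:R *: hsym (i - j) else 0).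
  case: (leqP j i) => ji.
    have ji1 : (j < i.+1)%N by [].
    rewrite (bigD1 (Ordinal ji1)) //= eqxx big1 ?addr0 // => l.
    by rewrite -val_eqE /= eq_sym => /negbTE ->; rewrite scale0r.
  by rewrite big1 // => l _; rewrite (_ : _ == _ = false) ?scale0r //; have := ltn_ord l; lia.
have [ji|ij] := leqP j i; last first.
  rewrite (_ : _ + _ = Negz (j - i.+1)); last lia.
  by rewrite ltnNge ltnW //= !scaler0 addr0.
rewrite (_ : _ + _ = Posz (i - j)) /=; last lia.
move: ji; rewrite leq_eqVlt => /orP[/eqP ->|ji].
  by rewrite ltnn scaler0 add0r natrM; fring.
rewrite ji !scalerA -scalerDl; congr (_ *: _).
by rewrite -!natrM -natrD; congr _%:R; lia.
Qed.

Lemma pder_hsymz j n : pder j (hsymz n) = 2%:R *: hsymz (n + Negz j).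
Proof.
case: n => i; first exact: pder_hsym.
by rewrite linear0 (_ : _ + _ = Negz (i + j).+1) ?scaler0 //; lia.
Qed.

Lemma degop_hsymz n : degop (hsymz n) = n%:~R *: hsymz n.
Proof.
case: n => i; last by rewrite linear0 scaler0.
elim/ltn_ind: i => -[|i] IHi; first by rewrite degop_vac scale0r.
apply: (@natrZ_inj i); rewrite -linearZ /= hsym_rec linear_sum /=.
rewrite scaler_sumr.
apply: eq_bigr => l _; have li := ltn_ord l.
rewrite degop_pmul -[hsym (i - l)]/(hsymz (i - l)%N) IHi; last lia.
rewrite linearZ /= -scalerDl -!pmulrn -natrD; congr (_%:R *: _); lia.
Qed.

(** The factor exp (- sum_n 2 (d/dp_n) z^-n) substitutes p_n - 2 z^-n for p_n. As z^-n shifts the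
    index of a coefficient, a step acts on the whole family of coefficients. *)
Definition vertex_step (j : nat) (phi : int -> F) : int -> F :=
  fun m => pmul j (phi m) - 2%:R *: phi (m + Negz j).

(* The coefficient of z^-m in the vertex operator
   exp (sum_n p_n z^n / n) exp (- sum_n 2 (d/dp_n) z^-n). *)
Definition vertex m f : F := ext vertex_step (fun m => hsymz (- m)) f m.

Lemma vertex_step_linear j : linear (vertex_step j).
Proof.
move=> a phi psi; apply/funext => m; rewrite /vertex_step !fctE linearP /=; fring.
Qed.

Lemma vertex_stepC i j phi : vertex_step i (vertex_step j phi) =
  vertex_step j (vertex_step i phi).
Proof.
apply/funext => m; rewrite /vertex_step !(linearB, linearZ) /=
  pmulC (addrAC m (Negz i) (Negz j)); fring.
Qed.

Lemma vertex_linear m : linear (vertex m).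
Proof. by move=> a f g; rewrite /vertex linearP. Qed.
HB.instance Definition _ m := GRing.isLinear.Build K F F *:%R (vertex m) (vertex_linear m).

Lemma vertex_vac m : vertex m vac = hsymz (- m).
Proof. by rewrite /vertex ext_vac //; exact: vertex_stepC. Qed.

Lemma vertex_pmul m j f : vertex m (pmul j f) = pmul j (vertex m f) - 2%:R *:
  vertex (m + Negz j) f.
Proof. by rewrite /vertex ext_pmul //; [exact: vertex_step_linear|exact: vertex_stepC]. Qed.

Lemma pder_vertex m j f : pder j (vertex m f) = vertex m (pder j f) + 2%:R *:
  vertex (m + j.+1%:Z) f.
Proof.
elim/(@fock_ind K F): f m => [|a f g IHf IHg|l f IHf] m.
- rewrite pder_vac linear0 add0r !vertex_vac pder_hsymz; congr (_ *: hsymz _); lia.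
- by rewrite !linearP /= IHf IHg; fring.
rewrite vertex_pmul linearB linearZ /= !pder_pmul !IHf !(linearD, linearZ) /= !vertex_pmul.
by rewrite (addrAC m (Negz l)); fring.
Qed.

(* Here and below, [vertex] maps charge [t] to charge [t + 2]. *)
Lemma heis_vertex t n m f : heis (t + 2%:R) n (vertex m f) = vertex m (heis t n f) + 2%:R *:
  vertex (m + n) f.
Proof.
case: n => [[|j]|j].
- by rewrite addr0 /heis linearZ /= scalerDl.
- exact: pder_vertex.
by rewrite /heis vertex_pmul; fring.
Qed.

Lemma degop_vertex m f : degop (vertex m f) = vertex m (degop f) - m%:~R *: vertex m f.
Proof.
elim/(@fock_ind K F): f m => [|a f g IHf IHg|l f IHf] m.
- by rewrite degop_vac linear0 add0r vertex_vac degop_hsymz rmorphN scaleNr.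
- by rewrite !linearP /= IHf IHg; fring.
rewrite vertex_pmul linearB linearZ /= !degop_pmul !IHf !(linearD, linearB, linearZ) /=
  !vertex_pmul.
by rewrite NegzE intrD mulrNz -pmulrn; fring.
Qed.

(** The involution p_n -> - p_n exchanges the charges t and -t. It gives the opposite vertex
    operators and the symmetry of the determinant. *)
Definition flip f : F := ext (fun j f => - pmul j f) vac f.
Lemma flip_linear : linear flip.
Proof. by move=> a f g; rewrite /flip linearP. Qed.
HB.instance Definition _ := GRing.isLinear.Build K F F *:%R flip flip_linear.

Lemma flip_vac : flip vac = vac.
Proof. by rewrite /flip ext_vac // => i j f; rewrite !linearN /= pmulC. Qed.

Lemma flip_pmul j f : flip (pmul j f) = - pmul j (flip f).
Proof.
rewrite /flip ext_pmul // => [l a g u|i l g]; last by rewrite !linearN /= pmulC.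
by rewrite linearP /=; fring.
Qed.

Lemma flip_pder j f : flip (pder j f) = - pder j (flip f).
Proof.
elim/(@fock_ind K F): f => [|a f g IHf IHg|l f IHf].
- by rewrite flip_vac pder_vac linear0 oppr0.
- by rewrite !linearP /= IHf IHg; fring.
by rewrite pder_pmul flip_pmul linearN linearD linearZ /= flip_pmul IHf pder_pmul linearN;
  fring.
Qed.

Lemma flip_heis t n f : flip (heis t n f) = - heis (- t) n (flip f).
Proof.
case: n => [[|j]|j]; rewrite /heis ?flip_pder ?flip_pmul //.
by rewrite linearZ /= scaleNr opprK.
Qed.

Lemma flip_virop t n f : flip (virop t n f) = virop (- t) n (flip f).
Proof.
elim/(@fock_ind K F): f => [|a f g IHf IHg|l f IHf].
- rewrite flip_vac !virop_vac; case: n => [[|n]|q] /=.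
  + by rewrite linearZ /= flip_vac sqrrN.
  + by rewrite linear0.
  + rewrite linearD !linearZ linear_sum /= flip_pmul flip_vac.
    under eq_bigr => i _ do rewrite flip_pmul flip_pmul flip_vac linearN opprK.
    by rewrite mulNr scaleNr scalerN.
- by rewrite !linearP /= IHf IHg.
by rewrite virop_pmul linearD linearZ /= !flip_pmul IHf flip_heis !linearN /= virop_pmul; fring.
Qed.

Lemma degop_flip f : degop (flip f) = flip (degop f).
Proof. by rewrite /degop flip_virop oppr0. Qed.

Lemma flip_mon s : flip (mon F s) = (-1) ^+ size s *: mon F s.
Proof.
elim: s => [|j s IHs]; first by rewrite flip_vac scale1r.
by rewrite -pmul_mon flip_pmul IHs linearZ /= exprS mulN1r scaleNr.
Qed.

Lemma cf_flip s f : cf s (flip f) = (-1) ^+ size s * cf s f.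
Proof.
elim/mon_ind: f => [a f g IHf IHg|u]; first by rewrite linearP /= !cfP IHf IHg; ring.
rewrite flip_mon cfZ cf_mon; case: (boolP (perm_eq s u)) => [/perm_size ->|_] //.
by rewrite !mulr0.
Qed.

Lemma vcf_flip f : vcf (flip f) = vcf f.
Proof. by rewrite /vcf cf_flip mul1r. Qed.

(* The vertex operator of the opposite charge. *)
Definition vertexN m f : F := flip (vertex m (flip f)).
Lemma vertexN_linear m : linear (vertexN m).
Proof. by move=> a f g; rewrite /vertexN !linearP. Qed.
HB.instance Definition _ m := GRing.isLinear.Build K F F *:%R (vertexN m) (vertexN_linear m).

Lemma vertexN_vac m : vertexN m vac = flip (hsymz (- m)).
Proof. by rewrite /vertexN flip_vac vertex_vac. Qed.

Lemma heis_vertexN t n m f : heis (t - 2%:R) n (vertexN m f) = vertexN m (heis t n f) - 2%:R *: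
  vertexN (m + n) f.
Proof.
have := heis_vertex (- t) n m (flip f) => /(congr1 flip).
rewrite flip_heis linearD linearZ /= -/(vertexN _ _) -/(vertexN _ _) opprD opprK => bE'.
by rewrite /vertexN -[t in heis t n f]opprK flip_heis opprK -/(vertexN _ _) -[LHS]opprK bE';
  fring.
Qed.

Lemma degop_vertexN m f : degop (vertexN m f) = vertexN m (degop f) - m%:~R *: vertexN m f.
Proof. by rewrite /vertexN degop_flip degop_vertex linearB linearZ /= degop_flip. Qed.

End Vertex.

Section VertexRel.
Context {K : numFieldType} {F : fockSpace K}.
Implicit Types (f g : F) (t : K) (m n : int).

Lemma vcf_vertex_pmul m j f : vcf (vertex m (pmul j f)) = - 2%:R * vcf (vertex (m + Negz j) f).
Proof. by rewrite vertex_pmul vcfB vcf_pmul vcfZ sub0r mulNr. Qed.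

(** These are the coefficients of x^n, for x = w/z, in the vacuum expectations of V(z) V(w) and V(z)
    V^-(w), which are (1 - x)^2 and (1 - x)^-2. *)
Definition vcf_vertex_hsymz n : K := vcf (vertex n (hsymz n : F)).
Definition vcf_vertex_flip_hsymz n : K := vcf (vertex n (flip (hsymz n : F))).

Lemma vcf_vertex_hsym_rec i : i.+1%:R * vcf_vertex_hsymz i.+1 = - 2%:R * \sum_(l < i.+1)
  vcf_vertex_hsymz l.
Proof.
have -> : i.+1%:R * vcf_vertex_hsymz i.+1 = vcf (vertex i.+1 (i.+1%:R *: hsym i.+1 : F)) by
  rewrite linearZ /= vcfZ.
rewrite hsym_rec linear_sum vcf_sum mulr_sumr (reindex_inj rev_ord_inj) /=.
apply: eq_bigr => l _; have li := ltn_ord l.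
rewrite vcf_vertex_pmul subSS (_ : _ + _ = l :> int); last lia.
by rewrite subKn.
Qed.

Lemma vcf_vertex_flip_hsym_rec i : i.+1%:R * vcf_vertex_flip_hsymz i.+1 =
  2%:R * \sum_(l < i.+1) vcf_vertex_flip_hsymz l.
Proof.
have -> : i.+1%:R * vcf_vertex_flip_hsymz i.+1 = vcf
  (vertex i.+1 (flip (i.+1%:R *: hsym i.+1 : F))).
  by rewrite linearZ /= linearZ /= vcfZ.
rewrite hsym_rec !linear_sum vcf_sum mulr_sumr (reindex_inj rev_ord_inj) /=.
apply: eq_bigr => l _; have li := ltn_ord l.
rewrite flip_pmul linearN vcfN vcf_vertex_pmul subSS (_ : _ + _ = l :> int); last lia.
by rewrite subKn // mulNr opprK.
Qed.

Lemma vcf_vertex_hsym_rec2 i : i.+2%:R * vcf_vertex_hsymz i.+2 = (i%:R - 1) * vcf_vertex_hsymz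
  i.+1.
Proof.
rewrite vcf_vertex_hsym_rec big_ord_recr /= mulrDr -vcf_vertex_hsym_rec -natr1; ring.
Qed.

Lemma vcf_vertex_hsym0 : vcf_vertex_hsymz 0 = 1.
Proof. by rewrite /vcf_vertex_hsymz /= vertex_vac /= vcf_vac. Qed.

Lemma vcf_vertex_hsym1 : vcf_vertex_hsymz 1 = - 2%:R.
Proof. by have := vcf_vertex_hsym_rec 0; rewrite big_ord1 vcf_vertex_hsym0 mul1r mulr1. Qed.

Lemma vcf_vertex_hsym2 : vcf_vertex_hsymz 2 = 1.
Proof.
have := vcf_vertex_hsym_rec2 0; rewrite vcf_vertex_hsym1 sub0r mulN1r opprK -[RHS]mulr1.
by apply: mulfI; rewrite pnatr_eq0.
Qed.

Lemma vcf_vertex_hsym_ge3 i : vcf_vertex_hsymz i.+3 = 0.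
Proof.
elim: i => [|i IHi].
  by have /eqP := vcf_vertex_hsym_rec2 1; rewrite subrr mul0r mulf_eq0 pnatr_eq0 => /eqP.
by have /eqP := vcf_vertex_hsym_rec2 i.+2; rewrite IHi mulr0 mulf_eq0 pnatr_eq0 => /eqP.
Qed.

Lemma vcf_vertex_hsymz_neg i : vcf_vertex_hsymz (Negz i) = 0.
Proof. by rewrite /vcf_vertex_hsymz /= linear0 vcf0. Qed.

(** The polynomial (1 - x)^2 is palindromic. *)
Lemma vcf_vertex_hsymz_sym a : vcf_vertex_hsymz (a + 2) = vcf_vertex_hsymz (- a).
Proof.
case: a => [[|i]|[|[|i]]].
- by rewrite add0r oppr0 vcf_vertex_hsym2 vcf_vertex_hsym0.
- rewrite (_ : _ + _ = i.+3%:Z) ?vcf_vertex_hsym_ge3; last lia.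
  by rewrite (_ : - _ = Negz i) ?vcf_vertex_hsymz_neg //; lia.
- by rewrite (_ : _ + _ = 1) // vcf_vertex_hsym1.
- by rewrite (_ : _ + _ = 0) // vcf_vertex_hsym0 (_ : - _ = 2) // vcf_vertex_hsym2.
- rewrite (_ : _ + _ = Negz i) ?vcf_vertex_hsymz_neg; last lia.
  by rewrite (_ : - _ = i.+3%:Z) ?vcf_vertex_hsym_ge3 //; lia.
Qed.

Lemma vcf_vertex_flip_hsym (i : nat) : vcf_vertex_flip_hsymz i = i.+1%:R.
Proof.
have at0 : vcf_vertex_flip_hsymz 0 = 1 by rewrite /vcf_vertex_flip_hsymz /=
  flip_vac vertex_vac /= vcf_vac.
case: i => [|i]; first exact: at0.
elim: i => [|i IHi].
  by have := vcf_vertex_flip_hsym_rec 0; rewrite big_ord1 at0 mul1r mulr1.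
have : i.+2%:R * vcf_vertex_flip_hsymz i.+2 = i.+3%:R * vcf_vertex_flip_hsymz i.+1.
  rewrite vcf_vertex_flip_hsym_rec big_ord_recr /= mulrDr -vcf_vertex_flip_hsym_rec; ring.
rewrite IHi mulrC => /mulIf; apply; by rewrite pnatr_eq0.
Qed.

Lemma vcf_vertex_flip_hsymz_neg i : vcf_vertex_flip_hsymz (Negz i) = 0.
Proof. by rewrite /vcf_vertex_flip_hsymz /= !linear0 vcf0. Qed.

Lemma vcf_virop_hsym t i : vcf (virop t i.+1 (hsym i.+1 : F)) = i%:R + t.
Proof.
apply: (@mulfI _ i.+1%:R); first by rewrite pnatr_eq0.
rewrite -vcfZ -linearZ /= hsym_rec linear_sum vcf_sum big_ord_recr /=.
rewrite virop_pmul vcfD vcf_pmul add0r vcfZ subnn (_ : i.+1%:Z + Negz i = 0); last lia.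
rewrite (_ : heis t 0 (hsym 0) = t *: (vac : F)) // vcfZ vcf_vac mulr1.
rewrite (eq_bigr (fun l : 'I_i => 2%:R * l.+1%:R)) => [|l _]; last first.
  have li := ltn_ord l.
  rewrite virop_pmul vcfD vcf_pmul add0r vcfZ (_ : _ + _ = (i - l.+1).+1%:Z); last lia.
  rewrite /heis pder_hsym vcfZ (_ : _ + _ = 0); last lia.
  by rewrite /= vcf_vac mulr1 mulrC.
suff -> : \sum_(l < i) 2%:R * l.+1%:R = i.+1%:R * i%:R :> K by ring.
elim: {t} i => [|i IHi]; first by rewrite big_ord0 mulr0.
by rewrite big_ord_recr /= IHi; ring.
Qed.

Lemma heis_vertex_neq0 t n m f : n != 0 -> heis t n (vertex m f) = vertex m (heis t n f) +
  2%:R *: vertex (m + n) f.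
Proof. by have := heis_vertex t n m f; case: n => [[|j]|j]. Qed.

Lemma heis_vertexN_neq0 t n m f : n != 0 -> heis t n (vertexN m f) = vertexN m (heis t n f) -
  2%:R *: vertexN (m + n) f.
Proof. by have := heis_vertexN t n m f; case: n => [[|j]|j]. Qed.

(** V(z) V(w) is (1 - w/z)^2 times a normally ordered product that is symmetric in z and w. Hence
    z^2 V(z) V(w) is symmetric, and these are its coefficients. *)
Lemma vertex_comm m n f : vertex (m + 2) (vertex n f) = vertex (n + 2) (vertex m f).
Proof.
pose T (x : int * int) f := vertex (x.1 + 2) (vertex x.2 f) - vertex (x.2 + 2) (vertex x.1 f).
apply/eqP; rewrite -subr_eq0; apply/eqP.
apply: (vac_zero (T := T) (deg := fun x => - (x.1 + x.2 + 2)) (t := 0) _ _ _ _ (m, n)) =>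
  {m n f}.
- by move=> u a f g; rewrite /T !linearP /=; fring.
- move=> [m n]; rewrite /T /= !(linearB, degop_vertex) /=
    !(linearB, linearZ, degop_vertex, degop_vac, linear0) /=.
  by rewrite rmorphN !intrD; fring.
- move=> [m n] /= mn; rewrite /T /= !vertex_vac vcfB.
  have -> : n = - (m + 2) by lia.
  rewrite opprK (_ : - (m + 2) + 2 = - m); last lia.
  by rewrite -!/(vcf_vertex_hsymz _) vcf_vertex_hsymz_sym subrr.
move=> [m n] j j0; exists 2%:R, 2%:R, (m + j, n), (m, n + j).
split=> [_|_|f]; [rewrite /=; lia..|rewrite /T /=].
rewrite linearB /= !heis_vertex_neq0 // !linearD !linearZ /= !(addrAC _ j 2); fring.
Qed.

(* The right-hand side vanishes for [m = t + 1], that is, for the zero mode at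
   charge [t]. *)
Lemma virop_vertex t n m f : virop (t + 2%:R) n (vertex m f) - vertex m (virop t n f) =
  (t + 1 - m%:~R) *: vertex (m + n) f.
Proof.
pose T m f := virop (t + 2%:R) n (vertex m f) - vertex m (virop t n f) - (t + 1 - m%:~R) *:
  vertex (m + n) f.
apply/eqP; rewrite -subr_eq0; apply/eqP.
apply: (vac_zero (T := T) (deg := fun x => - (x + n)) (t := t) _ _ _ _ m) => {m f}.
- by move=> u a f g; rewrite /T !linearP /=; fring.
- move=> m; rewrite /T !(linearB, linearZ, degop_vertex, degop_virop) /=
    !(linearB, linearZ, degop_virop, degop_vertex, degop_vac, linear0) /=.
  by rewrite rmorphN !intrD; fring.
- move=> m mn; have -> : m = - n by lia.
  rewrite /T !vcfE addNr [vcf (vertex 0 _)]vcf_vertex_hsym0 mulr1 vertex_vac opprK.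
  case: n {m mn T} => [[|i]|q].
  + rewrite oppr0 (_ : hsymz 0 = vac) // !virop_vac /= linearZ /=
      !vcfZ vcf_vac [vcf (vertex 0 _)]vcf_vertex_hsym0 subr0.
    by field.
  + rewrite virop_vac /= linear0 vcf0 vcf_virop_hsym rmorphN /= -pmulrn -natr1; ring.
  rewrite /= linear0 vcf0 virop_vac /= linearD !linearZ linear_sum !vcfE vcf_sum /=
    vcf_vertex_pmul.
  rewrite (_ : - Negz q + Negz q = 0) ?addNr // [vcf (vertex 0 _)]vcf_vertex_hsym0.
  rewrite (eq_bigr (fun=> 4%:R)) => [|i _]; last first.
    rewrite !vcf_vertex_pmul (_ : _ + _ = 0) ?[vcf (vertex 0 _)]vcf_vertex_hsym0;
      [ring|have := ltn_ord i; lia].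
  by rewrite sumr_const card_ord -mulr_natr NegzE rmorphN rmorphN /= -pmulrn -natr1; field.
move=> m j j0; exists 2%:R, 0, (m + j), m.
split=> [_||f]; [lia|by rewrite eqxx|].
(* Nonzero Heisenberg modes do not depend on the charge. *)
have chg : heis t j (virop (t + 2%:R) n (vertex m f)) =
  heis (t + 2%:R) j (virop (t + 2%:R) n (vertex m f)).
  by case: j j0 => [[|j]|j].
rewrite /T !(linearB, linearZ) /= chg heis_virop !heis_vertex !heis_vertex_neq0 // heis_virop
  !(linearD, linearZ) /=.
rewrite intrD (addrAC m n j) (addrA m j n); fring.
Qed.

(** The two products expand the same double pole at z = w in opposite regions, so their difference
    lives on the diagonal: the derivative of the delta function gives m, the delta function itself
    the Heisenberg mode. *)
Lemma vertex_vertexN_comm m n f : vertex (m - 1) (vertexN (n + 1) f) - vertexN (n - 1)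
  (vertex (m + 1) f) =
  if m + n == 0 then m%:~R *: f else heis 0 (m + n) f.
Proof.
pose T (x : int * int) f := vertex (x.1 - 1) (vertexN (x.2 + 1) f) - vertexN (x.2 - 1)
  (vertex (x.1 + 1) f) -
  (if x.1 + x.2 == 0 then x.1%:~R *: f else heis 0 (x.1 + x.2) f).
apply/eqP; rewrite -subr_eq0; apply/eqP.
apply: (vac_zero (T := T) (deg := fun x => - (x.1 + x.2)) (t := 0) _ _ _ _ (m, n)) => {m n f}.
- by move=> [m n] a f g; rewrite /T /=; case: ifP => _; rewrite !linearP /=; fring.
- move=> [m n]; rewrite /T /=; case: eqVneq => [mn|_];
  rewrite !(linearB, linearZ, degop_vertex, degop_vertexN, degop_heis) /=
    !(linearB, linearZ, degop_vertexN, degop_vertex, degop_heis, degop_vac, linear0) /=.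
    have -> : n = - m by lia.
    by rewrite subrr oppr0 !intrD !rmorphN /=; fring.
  by rewrite rmorphN /= !intrD !rmorphN /=; fring.
- move=> [m n] /= mn; have -> : n = - m by lia.
  rewrite /T /= subrr eqxx !vcfE vcf_vac mulr1 vertexN_vac vertex_vac.
  rewrite /vertexN vcf_flip (_ : - (- m + 1) = m - 1); last lia.
  rewrite (_ : - (m + 1) = - m - 1); last lia.
  rewrite -!/(vcf_vertex_flip_hsymz _); case: m {mn} => [[|m]|m].
  + have cz1 x : x = -1 -> vcf_vertex_flip_hsymz x = 0 by move=> ->;
      exact: vcf_vertex_flip_hsymz_neg 0.
    by rewrite !cz1 // !subr0.
  + rewrite (_ : - _ - 1 = Negz m.+1); last lia.
    rewrite (_ : _ - 1 = m%:Z); last lia.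
    by rewrite vcf_vertex_flip_hsym vcf_vertex_flip_hsymz_neg subr0 subrr.
  + rewrite (_ : - _ - 1 = m%:Z); last lia.
    rewrite (_ : _ - 1 = Negz m.+1); last lia.
    by rewrite vcf_vertex_flip_hsym vcf_vertex_flip_hsymz_neg sub0r NegzE rmorphN opprK addNr.
move=> [m n] j j0; exists 2%:R, (- 2%:R), (m + j, n), (m, n + j).
split=> [_|_|f]; [rewrite /=; lia..|rewrite /T /=].
rewrite !linearB /= !(heis_vertex_neq0, heis_vertexN_neq0) // !(linearD, linearB, linearZ) /=.
rewrite !(addrAC m j) !(addrAC n j) (addrA m n j).
have -> : heis 0 j (if m + n == 0 then m%:~R *: f else heis 0 (m + n) f) =
    (if m + n == 0 then m%:~R *: heis 0 j f else heis 0 (m + n) (heis 0 j f)) +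
    (if m + n + j == 0 then 2 * j else 0)%:~R *: f.
  case: eqVneq => [mn|mn]; first by rewrite mn add0r (negbTE j0) scale0r addr0 linearZ.
  by rewrite heisC (addrC j).
case: (m + n + j == 0); case: (m + n == 0); rewrite ?intrD ?rmorphM /=; fring.
Qed.

End VertexRel.

(** * Zero modes and the contravariant form *)

Section Screening.
Context {K : numFieldType} {F : fockSpace K}.
Implicit Types (f g x y : F) (t : K) (m n w z : int) (N : nat).

(* The [N]-th power of the zero mode of the vertex operator, from charge [w]
   to charge [w + 2 N]. *)
Fixpoint vpow N w f : F := if N is N'.+1 then vpow N' (w + 2) (vertex (w + 1) f) else f.

Lemma vpow_linear N w : linear (vpow N w).
Proof. by elim: N w => [|N IH] w a f g //=; rewrite linearP /= IH. Qed.
HB.instance Definition _ N w := GRing.isLinear.Build K F F *:%R (vpow N w) (vpow_linear N w).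

Lemma vpowSr N w f : vpow N.+1 w f = vertex (w + (2 * N)%:Z + 1) (vpow N w f).
Proof.
elim: N w f => [|N IH] w f; first by rewrite /= muln0 addr0.
by rewrite [LHS]/= -[vpow N _ _]/(vpow N.+1 _ _) IH /=; congr vertex; lia.
Qed.

Lemma vpow_virop N w n f : vpow N w (virop w%:~R n f) = virop (w + (2 * N)%:Z)%:~R n
  (vpow N w f).
Proof.
elim: N w f => [|N IH] w f /=; first by rewrite muln0 addr0.
have /eqP := virop_vertex (F := F) w%:~R n (w + 1) f.
rewrite intrD subrr scale0r subr_eq0 => /eqP <-.
have -> : w%:~R + 2%:R = (w + 2)%:~R :> K by rewrite intrD.
by rewrite IH; congr (virop _%:~R); lia.
Qed.

(** If the index of a mode is counted from the charge, [vertex_comm] says that the zero mode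
    commutes with every mode. *)
Lemma vpow_vertex N w a f : vpow N (w + 2) (vertex (w + a) f) = vertex (w + (2 * N)%:Z + a)
  (vpow N w f).
Proof.
elim: N w f => [|N IH] w f /=; first by rewrite muln0 addr0.
have -> : w + 2 + 1 = w + 1 + 2 by lia.
rewrite vertex_comm (_ : w + a + 2 = (w + 2) + a); last lia.
by rewrite IH; congr vertex; lia.
Qed.

(** Moving p_j past one zero mode leaves another mode of the vertex operator, which commutes with
    the remaining zero modes. So p_j costs at most one more power of e. *)
Lemma vpow_pmul_eq0 N w j f : vpow N w f = 0 -> vpow N.+1 w (pmul j f) = 0.
Proof.
elim: N w f => [|N IH] w f /=; first by move=> ->; rewrite !linear0.
move=> f0; rewrite vertex_pmul !(linearB, linearZ) /=.
have := IH (w + 2) (vertex (w + 1) f) f0; rewrite /= => ->.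
have := vpow_vertex N.+1 w (1 + Negz j) f; rewrite (addrA w 1 (Negz j)) /= => ->.
by rewrite f0 !linear0 addr0.
Qed.

(** The sl_2 relation e f - f e = w at charge w; the indices are those of the zero modes that start
    from the charges w - 2, w and w + 2. *)
Lemma vertex0_vertexN0 w f : vertex (w - 1) (vertexN (- w + 1) f) =
  vertexN (- w - 1) (vertex (w + 1) f) + w%:~R *: f.
Proof.
by have /eqP := vertex_vertexN_comm w (- w) f; rewrite subrr eqxx subr_eq => /eqP ->;
  rewrite [LHS]addrC.
Qed.

(** The sl_2 formula for [e^(N+1), f] on a vector of weight w. *)
Lemma vpow_vertexN N w y : vpow N.+1 (w - 2) (vertexN (- w + 1) y) =
  vertexN (- w - (2 * N)%:Z - 1) (vpow N.+1 w y) + (N.+1%:Z * (w + N%:Z))%:~R *: vpow N w y.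
Proof.
elim: N w y => [|N IH] w y.
  rewrite /= (_ : w - 2 + 1 = w - 1); last lia.
  by rewrite vertex0_vertexN0 muln0 mul1r addr0 subr0.
rewrite [LHS]/= -[vpow N _ _]/(vpow N.+1 _ _) subrK (_ : w - 2 + 1 = w - 1); last lia.
rewrite vertex0_vertexN0 linearD linearZ /= -[vpow N _ (vertex _ (vertexN _ _))]/(vpow N.+1 w
  _).
have := IH (w + 2) (vertex (w + 1) y); rewrite addrK (_ : - (w + 2) + 1 = - w - 1); last lia.
move=> /= ->; rewrite -addrA -scalerDl -intrD; congr (vertexN _ _ + _%:~R *: _); lia.
Qed.

(** Zero modes preserve L_0, which is the degree plus charge^2/4, and ((w + 2N)^2 - w^2)/4 = N (w +
    N). *)
Lemma degop_vpow N w f : degop (vpow N w f) = vpow N w (degop f) - (N%:Z * (w + N%:Z))%:~R *: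
  vpow N w f.
Proof.
elim: N w f => [|N IH] w f /=; first by rewrite mul0r scale0r subr0.
rewrite IH degop_vertex linearB linearZ /= -addrA -opprD -scalerDl -intrD.
congr (_ - _%:~R *: _); lia.
Qed.

Lemma vpow_nilp w z y : 0 <= w -> degop y = z%:~R *: y -> exists N, vpow N w y = 0.
Proof.
move=> w0 yz; exists `|z|.+1; apply: (@degop_lt0 _ _ (z - (`|z|.+1%:Z * (w + `|z|.+1%:Z)))).
  by rewrite degop_vpow yz linearZ /= -scalerBl -intrB.
nia.
Qed.

(** By [vpow_vertexN], e f - c with c = (N+1) (w+N) maps the kernel of e^(N+1) into that of e^N. As
    c is nonzero for w > 0, e f can be inverted by induction on N. *)
Lemma vertex0_vertexN0_surj w z y : 0 < w -> degop y = z%:~R *: y ->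
  exists2 x, degop x = z%:~R *: x & vertex (w - 1) (vertexN (- w + 1) x) = y.
Proof.
move=> w0 yz; have [N] := vpow_nilp (ltW w0) yz.
elim: N y yz => [|N IH] y yz /= y0.
  by exists 0; rewrite ?y0 !linear0 ?scaler0.
pose c : K := (N.+1%:Z * (w + N%:Z))%:~R.
have c0 : c != 0 by rewrite intr_eq0; nia.
have [||x xz xE] := IH (vertex (w - 1) (vertexN (- w + 1) y) - c *: y).
- rewrite linearB linearZ /= degop_vertex degop_vertexN yz !linearB !linearZ /=
    !intrD !rmorphN /=; fring.
- have := vpow_vertexN N w y; rewrite -[vpow N.+1 w y]/(vpow N (w + 2) _) y0 linear0 add0r /=
    subrK.
  by rewrite (_ : w - 2 + 1 = w - 1) -/c => [eE|]; [rewrite linearB linearZ /= eE subrr|lia].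
exists (c^-1 *: (y - x)).
  by rewrite linearZ linearB /= yz xz; fring.
by rewrite !linearZ !linearB /= xE opprB addrC subrK scalerA mulVf // scale1r.
Qed.

Lemma vpow_surj N w z y : 0 <= w -> degop y = z%:~R *: y ->
  exists2 x, degop x = (z + N%:Z * (w + N%:Z))%:~R *: x & vpow N w x = y.
Proof.
move=> w0; elim: N z y => [|N IH] z y yz; first by exists y; rewrite ?mul0r ?addr0.
have [|x xz xE] := vertex0_vertexN0_surj (w := w + (2 * N)%:Z + 2) _ yz; first lia.
have [|x' x'z x'E] := IH (z + (w + (2 * N)%:Z + 1)) (vertexN (- (w + (2 * N)%:Z + 2) + 1) x).
  by rewrite degop_vertexN xz linearZ /= -scalerBl -intrB; congr (_%:~R *: _); lia.
exists x'; first by rewrite x'z; congr (_%:~R *: _); lia.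
by rewrite vpowSr x'E -xE; congr vertex; lia.
Qed.

(** Since e f is onto at charge k + 2, some y has e f y = e x. Thus every homogeneous vector of F_k
    lies in ker e + im f. *)
Lemma ker_vertex0_dec (k : nat) z x : degop x = z%:~R *: x ->
  exists y, degop (x - vertexN (- k%:Z - 1) y) = z%:~R *: (x - vertexN (- k%:Z - 1) y) /\
     vertex (k%:Z + 1) (x - vertexN (- k%:Z - 1) y) = 0.
Proof.
move=> xz; have [||y yz yE] := vertex0_vertexN0_surj (w := k%:Z + 2) (z := z - (k%:Z + 1))
  (y := vertex (k%:Z + 1) x).
- lia.
- by rewrite degop_vertex xz linearZ /= -scalerBl -intrB.
have e1 : - (k%:Z + 2) + 1 = - k%:Z - 1 by lia.
have e2 : (k%:Z + 2) - 1 = k%:Z + 1 by lia.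
exists y; rewrite e1 e2 in yE; split; last by rewrite linearB /= yE subrr.
rewrite linearB /= degop_vertexN xz yz linearZ /= !(intrD, rmorphN) /=; fring.
Qed.

Lemma ker_vpow_incr M N w f : (M <= N)%N -> vpow M w f = 0 -> vpow N w f = 0.
Proof.
move=> /subnK <- f0; elim: (N - M)%N => // l IH.
by rewrite addSn vpowSr IH linear0.
Qed.

End Screening.

Section Form.
Context {K : numFieldType} {F : fockSpace K}.
Implicit Types (f g x y : F) (t : K) (m n w z : int) (N : nat).

(* The contravariant form, for which [pder j] is adjoint to [pmul j]. *)
Definition cform f g : K :=
  ext (fun j (phi : F -> K^o) g => phi (pder j g)) (fun g => vcf g : K^o) f g.

Lemma cformDl a f f' g : cform (a *: f + f') g = a * cform f g + cform f' g.
Proof. by rewrite /cform linearP. Qed.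

Lemma cform_vac g : cform vac g = vcf g.
Proof. by rewrite /cform ext_vac // => i j phi; apply/funext => g'; rewrite pderC. Qed.

Lemma cform_pmul j f g : cform (pmul j f) g = cform f (pder j g).
Proof.
by rewrite /cform ext_pmul // => i l phi; apply/funext => g'; rewrite pderC.
Qed.

Lemma cformDr a f g g' : cform f (a *: g + g') = a * cform f g + cform f g'.
Proof.
elim/(@fock_ind K F): f g g' => [|c f f' IHf IHf'|j f IHf] g g'.
- by rewrite !cform_vac vcfD vcfZ.
- by rewrite !cformDl IHf IHf'; ring.
by rewrite !cform_pmul linearP /= IHf.
Qed.

Lemma cform0 f : cform f 0 = 0.
Proof. by have := cformDr (- 1) f 0 0; rewrite scaler0 addr0 mulN1r addNr. Qed.
Lemma cformD f g g' : cform f (g + g') = cform f g + cform f g'.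
Proof. by rewrite -[g]scale1r cformDr mul1r scale1r. Qed.
Lemma cformZ a f g : cform f (a *: g) = a * cform f g.
Proof. by rewrite -[a *: g]addr0 cformDr cform0 addr0. Qed.

Lemma cform0l g : cform 0 g = 0.
Proof. by have := cformDl (- 1) 0 0 g; rewrite scaler0 addr0 mulN1r addNr. Qed.
Lemma cform_Dl f f' g : cform (f + f') g = cform f g + cform f' g.
Proof. by rewrite -[f]scale1r cformDl mul1r scale1r. Qed.
Lemma cformZl a f g : cform (a *: f) g = a * cform f g.
Proof. by rewrite -[a *: f]addr0 cformDl cform0l addr0. Qed.

Lemma cform_pder j f g : cform (pder j f) g = cform f (pmul j g).
Proof.
elim/(@fock_ind K F): f g => [|c f f' IHf IHf'|i f IHf] g.
- by rewrite pder_vac cform0l cform_vac vcf_pmul.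
- by rewrite linearP /= !cformDl IHf IHf'.
rewrite pder_pmul cform_Dl cformZl cform_pmul IHf cform_pmul pder_pmul cformD cformZ eq_sym.
by case: eqVneq => [->|].
Qed.

Lemma cform_heis t n f g : cform (heis t n f) g = cform f (heis t (- n) g).
Proof.
case: n => [[|j]|j]; first by rewrite /heis cformZl cformZ.
  by rewrite (_ : - Posz j.+1 = Negz j) // /heis cform_pder.
by rewrite (_ : - Negz j = Posz j.+1) // /heis cform_pmul.
Qed.

(** The case f = [vac] of [cform_virop]. *)
Lemma vcf_virop t n g : 0 <= n -> vcf (virop t n g) = cform (viropvac t (- n)) g.
Proof.
case: n => [[_|q _]|q q0]; [| |lia].
- have LE0 : viropvac t (- 0%:Z) = (t ^+ 2 / 4%:R) *: (vac : F) by [].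
  rewrite LE0; elim/(@fock_ind K F): g => [|c g g' IHg IHg'|j g IHg].
  + by rewrite virop_vac /= cformZl cform_vac vcfZ.
  + by rewrite linearP vcfD vcfZ IHg IHg' cformDr.
  have bN : heis t (0 + Negz j) g = pmul j g by rewrite add0r.
  rewrite virop_pmul bN.
  by rewrite vcfD vcfZ cformZl cform_vac !vcf_pmul !mulr0 addr0.
rewrite (_ : - Posz q.+1 = Negz q) //= cform_Dl !cformZl.
have form_sum : cform (\sum_(i < q) pmul i (pmul (q - i.+1) (vac : F))) g =
    \sum_(i < q) vcf (pder i (pder (q - i.+1) g)).
  elim/big_rec2: _ => [|i x y _ <-]; first by rewrite cform0l.
  by rewrite cform_Dl !cform_pmul cform_vac pderC.
rewrite form_sum cform_pmul cform_vac.
elim/(@fock_ind K F): g {form_sum} => [|c g g' IHg IHg'|j g IHg].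
- rewrite virop_vac /= vcf0 pder_vac vcf0 mulr0 add0r big1 ?mulr0 // => i _.
  by rewrite pder_vac linear0 vcf0.
- rewrite [in RHS](eq_bigr (fun i : 'I_q => c * vcf (pder i (pder (q - i.+1) g)) +
    vcf (pder i (pder (q - i.+1) g')))).
    by rewrite big_split -mulr_sumr !linearP /= !vcfD !vcfZ IHg IHg'; ring.
  by move=> i _; rewrite !linearP /= vcfD vcfZ.
rewrite virop_pmul vcfD vcf_pmul add0r vcfZ pder_pmul vcfD vcf_pmul add0r vcfZ.
rewrite (eq_bigr (fun i : 'I_q =>
   (if (q - i.+1)%N == j then 2 * (q - i.+1).+1 else 0)%:R * vcf (pder i g) +
   (if i == j :> nat then 2 * i.+1 else 0)%:R * vcf (pder (q - i.+1) g))); last first.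
  move=> i _; rewrite pder_pmul linearD linearZ /= pder_pmul !vcfD !vcfZ vcf_pmul add0r addrC.
  by [].
rewrite big_split (reindex_inj rev_ord_inj) /=.
under eq_bigr => i _ do rewrite subnSK // subKn ?(ltnW (ltn_ord i)) //.
have key (u : nat -> K) : \sum_(l < q) (if l == j :> nat then 2 * l.+1 else 0)%:R * u l =
    if (j < q)%N then (2 * j.+1)%:R * u j else 0.
  case: ltnP => jq.
    rewrite (bigD1 (Ordinal jq)) //= eqxx big1 ?addr0 // => l.
    by rewrite -val_eqE /= => /negbTE ->; rewrite mul0r.
  by rewrite big1 // => l _; rewrite (_ : _ == _ = false) ?mul0r //; have := ltn_ord l; lia.
rewrite !(key (fun l => vcf (pder (q - l.+1) g))).
case: (ltngtP j q) => jq.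
- rewrite (_ : _ + Negz j = (q - j.+1).+1%:Z); last lia.
  by rewrite /heis ?(gtn_eqF jq) ?(ltn_eqF jq) !natrM; field.
- rewrite (_ : _ + Negz j = Negz (j - q.+1)); last lia.
  by rewrite /heis vcf_pmul ?(gtn_eqF jq) ?(ltn_eqF jq) !mulr0 !mul0r; ring.
rewrite -jq (_ : _ + Negz j = 0); last lia.
by rewrite /heis vcfZ ?eqxx natrM; field.
Qed.

Lemma cform_virop t n f g : 0 <= n -> cform (virop t (- n) f) g = cform f (virop t n g).
Proof.
move=> n0; elim/(@fock_ind K F): f g => [|c f f' IHf IHf'|i f IHf] g.
- by rewrite virop_vac cform_vac vcf_virop.
- by rewrite linearP /= !cformDl IHf IHf'.
rewrite virop_pmul cform_Dl cformZl !cform_pmul IHf cform_heis -[pder i g]/(heis t i.+1 g).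
rewrite -[pder i (virop t n g)]/(heis t i.+1 (virop t n g)) heis_virop cformD cformZ.
by congr (_ + _ * cform _ (heis _ _ _)); lia.
Qed.

(** The case f = [vac] of [cform_vertexN]. *)
Lemma cform_flip_hsymz n g : cform (flip (hsymz n : F)) g = vcf (vertex n g).
Proof.
elim/(@fock_ind K F): g n => [|c f f' IHf IHf'|i f IHf] n.
- rewrite vertex_vac; case: n => [[|n]|n].
  + by rewrite oppr0 /= flip_vac cform_vac vcf_vac.
  + rewrite (_ : - _ = Negz n) //= vcf0.
    apply: (@mulfI _ n.+1%:R); first by rewrite pnatr_eq0.
    rewrite mulr0 -cformZl -linearZ /= hsym_rec linear_sum /=.
    elim/big_rec: _ => [|l x _ IHx]; first by rewrite cform0l.
    by rewrite cform_Dl IHx flip_pmul -scaleN1r cformZl cform_pmul pder_vac cform0 mulr0 addr0.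
  + rewrite (_ : - _ = n.+1%:Z) //= linear0 cform0l.
    apply/esym/(degop_vcf (n := n.+1)) => //; exact: (degop_hsymz n.+1).
- by rewrite cformDr IHf IHf' linearP vcfD vcfZ.
rewrite vertex_pmul vcfB vcf_pmul sub0r vcfZ -IHf -cform_pder.
have -> : pder i (flip (hsymz n)) = - flip (pder i (hsymz n : F)).
  by rewrite -[RHS]opprK [in RHS]opprK flip_pder opprK.
by rewrite pder_hsymz -scaleN1r cformZl linearZ /= cformZl mulN1r.
Qed.

(** For m = - k - 1 this makes the zero modes f : F_(k+2) -> F_k and e : F_k -> F_(k+2) adjoint. *)
Lemma cform_vertexN m f g : cform (vertexN m f) g = cform f (vertex (- m) g).
Proof.
elim/(@fock_ind K F): f g m => [|c f f' IHf IHf'|i f IHf] g m.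
- by rewrite vertexN_vac cform_flip_hsymz cform_vac.
- by rewrite linearP !cformDl IHf IHf'.
have -> : vertexN m (pmul i f) = pmul i (vertexN m f) + 2%:R *: vertexN (m + Negz i) f.
  by rewrite /vertexN flip_pmul linearN linearN /= vertex_pmul linearB linearZ /= flip_pmul;
    fring.
rewrite cform_Dl cformZl !cform_pmul !IHf -[pder i (vertex _ g)]/(heis 0 i.+1 (vertex _ g))
  heis_vertex_neq0 // cformD cformZ.
by congr (_ + _ * cform _ (vertex _ _)); lia.
Qed.

Lemma cform_nondeg g : (forall f, cform f g = 0) -> g = 0.
Proof.
move=> g0; apply: cf_inj => s; elim: s g g0 => [|j s IHs] g g0.
  by have := g0 vac; rewrite cform_vac.
have := cf_pder j s g; rewrite IHs => [/esym/eqP|f]; last by rewrite -cform_pmul g0.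
by rewrite mulf_eq0 pnatr_eq0 !muln_eq0 => /eqP.
Qed.

(** An element of ker e is orthogonal to im f by adjointness, and to all other degrees. If it is
    orthogonal to ker e too, [ker_vertex0_dec] makes it orthogonal to everything. *)
Lemma ker_vertex0_nondeg (k : nat) z g : degop g = z%:~R *: g -> vertex (k%:Z + 1) g = 0 ->
  (forall f, degop f = z%:~R *: f -> vertex (k%:Z + 1) f = 0 -> cform f g = 0) -> g = 0.
Proof.
move=> vcf_vertex_hsymz eg0 gperp; apply: cform_nondeg.
apply: mon_ind => [a f f' f0 f'0|s]; first by rewrite cformDl f0 f'0 mulr0 addr0.
have sdg := degop_mon (F := F) s; set d := sumn _ in sdg.
have [dz|dz] := eqVneq (d%:Z) z.
  have [|y [y1 y2]] := @ker_vertex0_dec K F k z (mon F s); first by rewrite -dz sdg pmulrn.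
  have := gperp _ y1 y2; rewrite -scaleN1r addrC cformDl cform_vertexN.
  by rewrite (_ : - (- k%:Z - 1) = k%:Z + 1) ?eg0 ?cform0 ?mulr0 ?add0r //; lia.
have /eqP := cform_virop 0 (mon F s) g (lexx 0).
rewrite oppr0 -!/(degop _) sdg vcf_vertex_hsymz cformZl cformZ -subr_eq0 -mulrBl pmulrn -intrB.
by rewrite mulf_eq0 intr_eq0 subr_eq0 (negbTE dz) => /eqP.
Qed.

End Form.

(** * Partitions *)

Section Partitions.
Local Open Scope nat_scope.

Definition lev (s : seq nat) : nat := sumn (map S s).

(* The sorted words of level [n] with letters in [a, a + l[. *)
Fixpoint ptns (l a n : nat) : seq (seq nat) :=
  if l is l'.+1 then
    flatten [seq [seq nseq (i %/ a.+1) a ++ s | s <- ptns l' a.+1 (n - i)]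
            | i <- iota 0 n.+1 & a.+1 %| i]
  else if n == 0 then [:: [::]] else [::].

Lemma lev_cat s s' : lev (s ++ s') = lev s + lev s'.
Proof. by rewrite /lev map_cat sumn_cat. Qed.

Lemma lev_nseq i a : lev (nseq i a) = i * a.+1.
Proof. by rewrite /lev map_nseq sumn_nseq mulnC. Qed.

Lemma lev_perm s s' : perm_eq s s' -> lev s = lev s'.
Proof. by move=> ss'; apply: perm_sumn; apply: perm_map. Qed.

Lemma sorted_perm_eq (s s' : seq nat) : sorted leq s -> sorted leq s' -> perm_eq s s' -> s = s'.
Proof. by apply: sorted_eq; [exact: leq_trans|exact: anti_leq]. Qed.

Lemma sorted_nseq_cat i a s : sorted leq s -> all (fun x => a <= x) s ->
  sorted leq (nseq i a ++ s).
Proof.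
move=> ss sa; elim: i => //= i IHi.
rewrite (path_sortedE leq_trans) IHi andbT all_cat sa andbT.
by apply/allP => x /nseqP[-> _].
Qed.

Lemma sorted_split a s : sorted leq s -> all (fun x => a <= x) s ->
  s = nseq (count_mem a s) a ++ [seq x <- s | x != a].
Proof.
move=> ss sa; apply: sorted_perm_eq => //.
  apply: sorted_nseq_cat; first by apply: (sorted_filter leq_trans).
  by apply/allP => x; rewrite mem_filter => /andP[_ /(allP sa)].
rewrite -size_filter -(all_pred1P _ _ (filter_all (pred1 a) s)).
by rewrite perm_sym (perm_filterC (pred1 a) s).
Qed.

Lemma mem_ptns l a n s : (s \in ptns l a n) =
  [&& sorted leq s, all (fun x => a <= x < a + l) s & lev s == n].
Proof.
elim: l a n s => [|l IHl] a n s.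
  case: s => [|x s] /=; first by rewrite eq_sym; case: ifP.
  have -> : (a <= x < a + 0) = false by lia.
  by rewrite andbF; case: ifP.
apply/flatten_mapP/and3P => [[d]|[ss sa /eqP sn]].
  rewrite mem_filter mem_iota add0n ltnS leq0n /= => /andP[/dvdnP[q ->]] qn.
  case/mapP => s'; rewrite IHl mulnK // => /and3P[ss' sa' /eqP sn'] ->; split.
  - apply: sorted_nseq_cat => //; apply: sub_all sa' => x; lia.
  - rewrite all_cat; apply/andP; split; last by apply: sub_all sa' => x; lia.
    by apply/allP => x /nseqP[-> _]; lia.
  - by rewrite lev_cat lev_nseq sn' subnKC.
have sge : all (fun x => a <= x) s by apply: sub_all sa => x /andP[].
have sE := sorted_split ss sge; set s' := [seq x <- s | _] in sE.
have := congr1 lev sE; rewrite lev_cat lev_nseq sn => nE.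
exists (count_mem a s * a.+1).
  by rewrite mem_filter mem_iota dvdn_mull //; lia.
rewrite mulnK //; apply/mapP; exists s'; last exact: sE.
rewrite IHl nE addKn eqxx andbT sorted_filter //=; last exact: leq_trans.
by apply/allP => x; rewrite mem_filter => /andP[xa /(allP sa)]; lia.
Qed.

Lemma uniq_ptns l a n : uniq (ptns l a n).
Proof.
elim: l a n => [|l IHl] a n; first by rewrite /=; case: ifP.
apply: (@allpairs_uniq_dep nat (fun=> seq nat) (seq nat)
  (fun i s => nseq (i %/ a.+1) a ++ s) _ (fun i => ptns l a.+1 (n - i))).
- exact/filter_uniq/iota_uniq.
- by move=> i _; apply: IHl.
move=> [i s] [i' s'] /allpairsPdep[x [y [xi yi [-> ->]]]]
  /allpairsPdep[x' [y' [xi' yi' [-> ->]]]] /= e.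
have cy j z m : z \in ptns l j.+1 m -> count_mem j z = 0.
  rewrite mem_ptns => /and3P[_ /allP zj _]; apply/count_memPn; apply/negP => /zj; lia.
have ii' : x %/ a.+1 = x' %/ a.+1.
  by have := congr1 (count_mem a) e; rewrite !count_cat !count_nseq /=
    eqxx (cy _ _ _ yi) (cy _ _ _ yi'); lia.
have xx' : x = x'.
  move: xi xi'; rewrite !mem_filter => /andP[/divnK <- _] /andP[/divnK <- _].
  by rewrite ii'.
by subst x'; move/eqP: e; rewrite eqseq_cat // eqxx => /eqP ->.
Qed.

Definition parts n := ptns n 0 n.

Lemma lev_ge (x : nat) s : x \in s -> x < lev s.
Proof. by move=> xs; rewrite (lev_perm (perm_to_rem xs)) /lev /= ltnS leq_addr. Qed.

Lemma mem_parts n s : (s \in parts n) = sorted leq s && (lev s == n).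
Proof.
rewrite mem_ptns; case: (sorted leq s) => //=.
by case: eqP => [<-|]; rewrite ?andbF // andbT add0n; apply/allP => x /lev_ge ->.
Qed.

Lemma uniq_parts n : uniq (parts n). Proof. exact: uniq_ptns. Qed.

Lemma parts_perm n s : lev s = n -> sort leq s \in parts n.
Proof.
move=> sn; rewrite mem_parts sort_sorted ?leq_total //= -sn.
by apply/eqP/lev_perm/permPl/perm_sort.
Qed.

Lemma parts_inj n s s' : s \in parts n -> s' \in parts n -> perm_eq s s' -> s = s'.
Proof.
rewrite !mem_parts => /andP[ss _] /andP[ss' _]; exact: sorted_perm_eq.
Qed.

Definition npart n := size (parts n).

(** [ptns] runs over the total contribution i of the letter a, a multiple of a + 1, instead of its
    multiplicity, so its recursion is a product with [ps_geom]. *)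
Lemma size_ptns l a n :
  (size (ptns l a n))%:Z%R = (\big[ps_mul/ps_one]_(k <- iota a.+1 l) ps_geom k) n.
Proof.
elim: l a n => [|l IHl] a n; first by rewrite big_nil /ps_one /=; case: eqP.
rewrite [iota _ _]/= big_cons /ps_mul -[ptns l.+1 a n]/(flatten _) size_flatten sumnE !big_map
  big_filter.
rewrite -[iota 0 n.+1]/(index_iota 0 n.+1) big_mkord big_mkcond /= -natz natr_sum.
apply: eq_bigr => i _; rewrite -IHl /ps_geom; case: ifP => _.
  by rewrite size_map mul1r natz.
by rewrite mul0r.
Qed.

Lemma ps_phi_npart n : ps_phi n = (npart n)%:Z%R.
Proof. by rewrite /npart /parts size_ptns /ps_phi /index_iota subn1. Qed.

Definition npart_sub n m := if m <= n then npart (n - m) else 0.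

Lemma npart_subB n a heis : a <= n -> npart_sub (n - a) heis = npart_sub n (heis + a).
Proof. by move=> an; rewrite /npart_sub leq_subRL // addnC -subnDA addnC. Qed.

(** Removing one letter j is injective on these sorted words; the induction removes r of them. *)
Lemma count_ge n j r : count (fun s => r <= count_mem j s) (parts n) <= npart_sub n (r * j.+1).
Proof.
elim: r n => [|r IHr] n.
  by rewrite mul0n /npart_sub leq0n subn0 (eq_count (a2 := predT)) ?count_predT.
set A := [seq s <- parts n | r < count_mem j s].
rewrite -size_filter -/A.
have jA s : s \in A -> [/\ j \in s, r < count_mem j s, sorted leq s & lev s = n].
  rewrite mem_filter mem_parts => /andP[rs /andP[ss /eqP]]; split=> //.
  by rewrite -has_pred1 has_count (leq_ltn_trans _ rs).
have remA s : s \in A -> lev (rem j s) + j.+1 = n.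
  by move=> /jA[js _ _ <-]; rewrite (lev_perm (perm_to_rem js)) /lev /= addnC.
case: (leqP j.+1 n) => jn; last first.
  case AE: A => [//|s A'].
  by have := remA s; rewrite AE mem_head => /(_ isT); lia.
rewrite mulSn addnC -npart_subB //; apply: leq_trans (IHr _).
rewrite -size_filter -(size_map (rem j)); apply: uniq_leq_size.
  rewrite map_inj_in_uniq ?filter_uniq ?uniq_parts // => s s' sA s'A e.
  have [js _ ss _] := jA s sA; have [js' _ ss' _] := jA s' s'A.
  apply: sorted_perm_eq => //.
  by rewrite (permPl (perm_to_rem js)) e perm_sym perm_to_rem.
move=> _ /mapP[s sA ->]; have [js rs ss _] := jA s sA.
rewrite mem_filter mem_parts (subseq_sorted leq_trans (rem_subseq _ _) ss).
have := seq.permP (perm_to_rem js) (pred1 j); rewrite /= eqxx add1n => cE.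
by rewrite -ltnS -cE rs /=; have := remA s sA; lia.
Qed.

Lemma size_le_lev s : size s <= lev s.
Proof. by elim: s => //= x s IHs; rewrite /lev /= -/(lev s); lia. Qed.

(** The length of a word is the number of pairs (j, r) with r smaller than the multiplicity of j. *)
Lemma sum_size_parts n :
  \sum_(s <- parts n) size s <= \sum_(j < n) \sum_(r < n) npart_sub n (r.+1 * j.+1).
Proof.
have sizeE s : s \in parts n -> size s = \sum_(j < n) \sum_(r < n) (r < count_mem (j : nat) s).
  rewrite mem_parts => /andP[_ /eqP sn].
  have -> : size s = \sum_(j < n) count_mem (j : nat) s.
    have: all (fun x => x < n) s by apply/allP => x /lev_ge; rewrite sn.
    elim: s {sn} => [|x s IHs] /=; first by rewrite big1.
    move=> /andP[xn /IHs ->]; rewrite big_split /= [X in _ = X + _](bigD1 (Ordinal xn)) //=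
      eqxx.
    rewrite [X in _ = _ + X + _]big1 ?addn0 // => i; rewrite -val_eqE /= eq_sym.
    by move=> /negbTE ->.
  apply: eq_bigr => j _; move: (count_mem (j : nat) s) (count_size (pred1 (j : nat)) s) => c cs.
  have cn : c <= n by rewrite -sn (leq_trans cs) // size_le_lev.
  by rewrite -big_mkcond /= -(big_ord_widen n (fun=> 1)) // sum1_card card_ord.
rewrite (eq_big_seq _ sizeE) exchange_big /=; apply: leq_sum => j _.
rewrite exchange_big /=; apply: leq_sum => r _.
by rewrite -big_mkcond sum1_count; apply: count_ge.
Qed.

(* [vmult n k] is a lower bound for the order of vanishing, at charge [k] or
   [- k], of the determinant of degree [n]. *)
Definition vmult n k := \sum_(s < n) npart_sub n (s.+1 * (s.+1 + k)).

Lemma sum_shift_le n j (g : nat -> nat) :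
  \sum_(r < n | j <= r) g r <= \sum_(0 <= k < n) g (j + k).
Proof.
rewrite -(big_mkord (fun r => j <= r)) -(big_nat_widenl j 0 n predT) //.
rewrite -{1}[j]add0n big_addn [leqRHS](big_cat_nat (n := n - j)) ?leq_subr //=.
by rewrite (eq_bigr (fun k => g (j + k))) ?leq_addr // => k _; rewrite addnC.
Qed.

(** The pairs with j <= r are counted by s = j, k = r - j, and the others by s = r, k = j - r >= 1;
    these are the contributions of the charges k and -k. *)
Lemma sum_npart_sub_le n : \sum_(j < n) \sum_(r < n) npart_sub n (r.+1 * j.+1) <=
  \sum_(k < n) vmult n k + \sum_(1 <= k < n) vmult n k.
Proof.
rewrite (eq_bigr (fun j : 'I_n => \sum_(r < n | j <= r) npart_sub n (r.+1 * j.+1) +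
  \sum_(r < n | ~~ (j <= r)) npart_sub n (r.+1 * j.+1))); last first.
  by move=> j _; rewrite (bigID (fun r : 'I_n => j <= r)).
rewrite big_split /=; apply: leq_add.
  rewrite [leqRHS]exchange_big /=; apply: leq_sum => j _.
  apply: leq_trans (sum_shift_le n j (fun r => npart_sub n (r.+1 * j.+1))) _.
  by rewrite big_mkord; apply: leq_sum => k _; rewrite mulnC addSn.
rewrite [leqRHS]exchange_big [leqLHS](exchange_big_dep predT) //=; apply: leq_sum => r _.
under eq_bigl => j do rewrite -ltnNge.
apply: leq_trans (sum_shift_le n r.+1 (fun j => npart_sub n (r.+1 * j.+1))) _.
rewrite big_add1 /=; case: n r => [|n] r; first by rewrite !big_geq.
(* The term in excess vanishes, because (r+1) (r+n+2) > n+1. *)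
rewrite big_nat_recr //= [npart_sub _ (r.+1 * _)]/npart_sub ifF; last by apply/negbTE;
  rewrite -ltnNge; nia.
by rewrite addn0; apply: leq_sum => k _; rewrite !addSn addnS.
Qed.

End Partitions.

(** * Orders of vanishing of determinants *)

Section Determinants.
Context {K : fieldType}.
Implicit Types (p q : {poly K}).

Lemma sum_mup_le (rs : seq K) p : p != 0 -> uniq rs ->
  (\sum_(x <- rs) mup x p <= (size p).-1)%N.
Proof.
elim: rs p => [|x rs IH] p p0 /=; first by rewrite big_nil.
case/andP => xrs urs; rewrite big_cons.
have := mup_geq x (mup x p) p0; rewrite leqnn => /esym/dvdpP[q pE].
move: pE; set m := mup x p => pE.
have q0 : q != 0 by apply: contraNneq p0 => q0; rewrite pE q0 mul0r.
have -> : (size p).-1 = (m + (size q).-1)%N.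
  rewrite pE size_mul ?expf_neq0 ?polyXsubC_eq0 // size_exp_XsubC.
  by move: q0; rewrite -size_poly_gt0; case: (size q) => // l _; rewrite addnS addSn addnC.
rewrite leq_add2l; apply: leq_trans (IH q q0 urs).
rewrite leq_eqVlt; apply/orP; left; apply/eqP; apply: eq_big_seq => y yrs.
rewrite pE mupMl // /root horner_exp !hornerE expf_neq0 // subr_eq0.
by apply: contraNneq xrs => <-.
Qed.

Definition topc p d c := ((size p <= d.+1)%N /\ p`_d = c).

Lemma topcM p q d e c c' : topc p d c -> topc q e c' -> topc (p * q) (d + e) (c * c').
Proof.
move=> [sp <-] [sq <-]; split.
  by apply: leq_trans (size_polyMleq p q) _; lia.
have dlt : (d < (d + e).+1)%N by rewrite ltnS leq_addr.
rewrite coefM (bigD1 (Ordinal dlt)) //= addKn big1 ?addr0 // => j.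
rewrite -val_eqE /= => jd; case: (ltngtP j d) jd => // jd _.
  by rewrite [X in _ * X]nth_default ?mulr0 // (leq_trans sq) //; lia.
by rewrite nth_default ?mul0r // (leq_trans sp).
Qed.

(** Each term of the Leibniz expansion takes one entry from every row, so the row degrees add up. *)
Lemma det_topc N (A : 'M[{poly K}]_N) (d : 'I_N -> nat) :
  (forall i j, size (A i j) <= (d i).+1)%N ->
  topc (\det A) (\sum_i d i) (\det (\matrix_(i, j) (A i j)`_(d i))).
Proof.
move=> Ad.
have key (s : 'S_N) : topc (\prod_i A i (s i)) (\sum_i d i)
    (\prod_i (\matrix_(i, j) (A i j)`_(d i)) i (s i)).
  elim/big_rec3: _ => [|i c e p _ IH]; first by rewrite /topc size_poly1 coef1.
  by apply: topcM => //; split; [exact: Ad|rewrite mxE].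
rewrite /determinant; split.
  apply: (leq_trans (size_sum _ _ _)); apply/bigmax_leqP => s _.
  by have [ks _] := key s; rewrite -[(-1) ^+ s]/(_) mulr_sign; case: ifP; rewrite ?size_polyN.
rewrite coef_sum; apply: eq_bigr => s _; have [_ <-] := key s.
by rewrite !mulr_sign; case: ifP; rewrite ?coefN.
Qed.

Lemma coef_mulmxC N (A : 'M[{poly K}]_N) (Q : 'M[K]_N) t :
  map_mx (coefp t) (A *m map_mx polyC Q) = map_mx (coefp t) A *m Q.
Proof.
apply/matrixP => i j; rewrite !mxE /coefp coef_sum; apply: eq_bigr => l _.
by rewrite !mxE coefMC.
Qed.

(* If the coefficient of X^t in the rows of [A] lies in the [t]-th step of a
   flag, then a change of basis adapted to the first step makes some columns
   divisible by X; dividing them by X shifts the flag by one step. *)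
Lemma det_flag N S (A : 'M[{poly K}]_N) (U : nat -> 'M[K]_N) :
  (forall s, (s.+1 < S)%N -> (U s <= U s.+1)%MS) ->
  (forall t s, (t <= s)%N -> (s < S)%N -> (map_mx (coefp t) A <= U s)%MS) ->
  'X^(\sum_(s < S) (N - \rank (U s))) %| \det A.
Proof.
elim: S A U => [|S IHS] A U UU AU; first by rewrite big_ord0 dvd1p.
have U0 s : (s < S.+1)%N -> (U 0%N <= U s)%MS.
  elim: s => // s IHs sS; apply: submx_trans (UU s sS); apply: IHs; exact: ltnW.
set r := \rank (U 0%N); set Q := row_ebase (U 0%N).
have Qu : Q \in unitmx by exact: row_ebase_unit.
pose A' := A *m map_mx polyC (invmx Q).
have AE : A = A' *m map_mx polyC Q.
  by rewrite /A' -mulmxA -map_mxM mulVmx // map_mx1 mulmx1.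
rewrite AE det_mulmx dvdp_mulr //.
pose d := \row_(j < N) (if (j < r)%N then 1 else 'X : {poly K}).
pose B := \matrix_(i, j) (if (j < r)%N then A' i j else drop_poly 1 (A' i j)).
(* In the coordinates given by Q, the row space of U_0 is spanned by the first r coordinate
   vectors. *)
have pidU : ((pid_mx r : 'M_N) <= U 0%N *m invmx Q)%MS.
  have {1}-> : U 0%N = col_ebase (U 0%N) *m pid_mx r *m Q by rewrite mulmx_ebase.
  rewrite -(mulmxA _ Q) mulmxV // mulmx1 -{1}[pid_mx r]mul1mx.
  by rewrite -(mulVmx (col_ebase_unit (U 0%N))) -mulmxA submxMl.
have Upid : (U 0%N *m invmx Q <= (pid_mx r : 'M_N))%MS.
  have {1}-> : U 0%N = col_ebase (U 0%N) *m pid_mx r *m Q by rewrite mulmx_ebase.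
  by rewrite -(mulmxA _ Q) mulmxV // mulmx1 submxMl.
have A't t : map_mx (coefp t) A' = map_mx (coefp t) A *m invmx Q by exact: coef_mulmxC.
have A'0 i (j : 'I_N) : (r <= j)%N -> (A' i j)`_0 = 0.
  move=> rj; have : (map_mx (coefp 0) A' <= (pid_mx r : 'M_N))%MS.
    by rewrite A't; apply: submx_trans Upid; apply: submxMr; apply: AU.
  case/submxP => W /matrixP/(_ i j); rewrite !mxE /coefp => ->.
  by apply: big1 => l _; rewrite !mxE ltnNge; case: eqVneq => [->|]; rewrite ?rj ?mulr0.
have A'E : A' = B *m diag_mx d.
  rewrite mul_mx_diag; apply/matrixP => i j.
  rewrite [RHS]mxE [B i j]mxE [d 0 j]mxE; case: ltnP => jr; first by rewrite mulr1.
  rewrite -{1}[A' i j](poly_take_drop 1) expr1 -[RHS]add0r; congr (_ + _).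
  apply/polyP => l; rewrite coef_take_poly coef0.
  by case: l => [|l] //=; exact: A'0.
rewrite A'E det_mulmx mulrC det_diag.
have -> : \prod_i d 0 i = 'X^(N - r).
  rewrite (eq_bigr (fun i : 'I_N => if (i < r)%N then 1 else 'X)) => [|i _];
    last by rewrite mxE.
  rewrite (bigID (fun i : 'I_N => (i < r)%N)) /= big1 => [|i ->] //; rewrite mul1r.
  rewrite (eq_bigr (fun=> 'X)) => [|i /negbTE ->] //.
  rewrite prodr_const; congr ('X^_).
  have -> : (N - r = \sum_(i < N | ~~ (i < r)) 1)%N.
    have rE : (\sum_(i < N | i < r) 1 = r)%N.
      by rewrite -(big_ord_widen N (fun=> 1%N)) ?rank_leq_row // sum1_card card_ord.
    have NE : (N = r + \sum_(i < N | ~~ (i < r)) 1)%N.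
      rewrite -{1}rE -(bigID (fun i : 'I_N => (i < r)%N) predT) /=.
      by rewrite sum1_card card_ord.
    by rewrite {1}NE addKn.
  by rewrite sum1_card.
rewrite big_ord_recl exprD dvdp_mul //; last first.
  rewrite (eq_bigr (fun s : 'I_S => N - \rank (U s.+1 *m invmx Q)))%N; last first.
    by move=> s _; rewrite mxrankMfree // row_free_unit unitmx_inv.
  apply: (IHS B (fun s => U s.+1 *m invmx Q)) => [s sS|t s ts sS]; first by apply: submxMr;
    apply: UU.
  (* Dividing a column by X moves its coefficient of X^(t+1) to X^t. So the condition on B for t <=
     s follows from the one on A' for t + 1 <= s + 1. *)
  have -> : map_mx (coefp t) B = map_mx (coefp t) A' *m pid_mx r + map_mx (coefp t.+1) A' *m
    copid_mx r.
    apply/matrixP => i j; rewrite mxE [B i j]mxE [RHS]mxE.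
    have pidE (X : 'M[K]_N) : (X *m pid_mx r) i j = if (j < r)%N then X i j else 0.
      rewrite mxE (bigD1 j) //= mxE eqxx /= big1 ?addr0 => [|l lj]; first by case: ifP;
        rewrite ?mulr1 ?mulr0.
      by rewrite mxE (_ : (l == j :> nat) = false) ?mulr0 //; apply/negbTE.
    have copidE (X : 'M[K]_N) : (X *m copid_mx r) i j = X i j - (X *m pid_mx r) i j.
      by rewrite mulmxBr mulmx1 [LHS]mxE [X in _ + X]mxE.
    rewrite copidE !pidE ![map_mx _ _ i j]mxE.
    case: ifP => _; first by rewrite subrr addr0.
    by rewrite add0r subr0 /= coef_drop_poly addn1.
  have pidUs : ((pid_mx r : 'M_N) <= U s.+1 *m invmx Q)%MS.
    by apply: submx_trans pidU _; apply: submxMr; apply: U0.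
  have A'U l : (l <= s.+1)%N -> (map_mx (coefp l) A' <= U s.+1 *m invmx Q)%MS.
    by move=> ls; rewrite A't; apply: submxMr; apply: AU.
  apply: addmx_sub.
    by apply: submx_trans pidUs; apply: submxMl.
  rewrite mulmxBr mulmx1 addmx_sub ?A'U // -mulmxN.
  by apply: submx_trans (submxMl _ _) _; rewrite eqmx_opp.
Qed.

End Determinants.

(** * The determinant of the words as a polynomial in the charge *)

Section PolyExt.
Context {K : numFieldType}.
Implicit Types p q : {poly K}.

Lemma poly_ext p q : (forall x, p.[x] = q.[x]) -> p = q.
Proof.
move=> pq; apply/eqP; rewrite -subr_eq0; apply/negPn/negP => r0.
have := @max_poly_roots _ (p - q) [seq i%:R | i <- iota 0 (size (p - q))] r0.
rewrite size_map size_iota ltnn map_inj_uniq ?iota_uniq => [H|i j /eqP]; last first.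
  by rewrite eqr_nat => /eqP.
by suff: false by []; apply: H => //; apply/allP => x _; rewrite rootE hornerD hornerN pq subrr.
Qed.

End PolyExt.

Section Coordinates.
Context {K : numFieldType} {F : fockSpace K}.
Implicit Types (f g : F) (c e x : K) (n k t : nat) (s : seq nat).

Definition nthpart n (i : 'I_(npart n)) : seq nat := nth [::] (parts n) i.

Lemma nthpart_parts n (i : 'I_(npart n)) : nthpart i \in parts n.
Proof. by apply: mem_nth; apply: ltn_ord. Qed.

Lemma lev_nthpart n (i : 'I_(npart n)) : lev (nthpart i) = n.
Proof. by have := nthpart_parts i; rewrite mem_parts => /andP[_ /eqP]. Qed.

Lemma nthpart_perm n (i j : 'I_(npart n)) : perm_eq (nthpart i) (nthpart j) = (i == j).
Proof.
apply/idP/eqP => [ij|->]; last exact: perm_refl.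
have := parts_inj (nthpart_parts i) (nthpart_parts j) ij; rewrite /nthpart => /eqP.
by rewrite nth_uniq ?uniq_parts //; [move/eqP/val_inj|apply: ltn_ord..].
Qed.

Lemma nthpart_surj n s : lev s = n -> exists i : 'I_(npart n), perm_eq s (nthpart i).
Proof.
move=> sn; have sp := parts_perm sn; have ip : (index (sort leq s) (parts n) < npart n)%N.
  by rewrite index_mem.
exists (Ordinal ip); rewrite /nthpart nth_index // perm_sym; exact/permPl/perm_sort.
Qed.

Definition coords n f : 'rV[K]_(npart n) := \row_j cf (nthpart j) f.
Definition of_coords n (u : 'rV[K]_(npart n)) : F := \sum_i u 0 i *: mon F (nthpart i).

Definition homog n f := degop f = n%:R *: f.

Lemma cf_degop_lev s f : cf s (degop f) = (lev s)%:R * cf s f.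
Proof. exact: cf_degop. Qed.

Lemma homog_mon s : homog (lev s) (mon F s).
Proof. exact: degop_mon. Qed.

Lemma homogP n a f g : homog n f -> homog n g -> homog n (a *: f + g).
Proof. by rewrite /homog linearP /= => -> ->; fring. Qed.

Lemma homog0 n : homog n 0.
Proof. by rewrite /homog linear0 scaler0. Qed.

Lemma homog_sum n I (r : seq I) (A : pred I) (u : I -> K) (vertexN : I -> F) :
  (forall i, A i -> homog n (vertexN i)) -> homog n (\sum_(i <- r | A i) u i *: vertexN i).
Proof. by move=> Gn; elim/big_rec: _ => [|i y Ai]; [exact: homog0|apply/homogP/Gn]. Qed.

Lemma cf_of_coords n (u : 'rV[K]_(npart n)) j : cf (nthpart j) (of_coords u) = u 0 j.
Proof.
rewrite cf_sum (bigD1 j) //= cfZ cf_mon perm_refl mulr1 big1 ?addr0 // => i ij.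
by rewrite cfZ cf_mon nthpart_perm eq_sym (negbTE ij) mulr0.
Qed.

Lemma of_coordsK n (u : 'rV[K]_(npart n)) : coords n (of_coords u) = u.
Proof. by apply/rowP => j; rewrite mxE cf_of_coords. Qed.

Lemma homog_of_coords n (u : 'rV[K]_(npart n)) : homog n (of_coords u).
Proof. by apply: homog_sum => i _; rewrite -{1}(lev_nthpart i); apply: homog_mon. Qed.

Lemma homog_eq n f g : homog n f -> homog n g -> coords n f = coords n g -> f = g.
Proof.
move=> fn gn fg; apply: cf_eq => s.
have [/nthpart_surj[i si]|sn] := eqVneq (lev s) n.
  have cfs (h : F) : cf s h = cf (nthpart i) h.
    elim/(@mon_ind K F): h => [a h h' IH IH'|u]; first by rewrite !cfP IH IH'.
    by rewrite !cf_mon (permPl si).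
  by move/rowP/(_ i): fg; rewrite !mxE !cfs.
have c0 (h : F) : homog n h -> cf s h = 0.
  move=> hn; have /eqP := cf_degop_lev s h; rewrite hn cfZ -subr_eq0 -mulrBl mulf_eq0 subr_eq0.
  by rewrite eqr_nat eq_sym (negbTE sn) => /eqP.
by rewrite !c0.
Qed.

Lemma coordsK n f : homog n f -> of_coords (coords n f) = f.
Proof. by move=> fn; apply: (homog_eq (homog_of_coords _) fn); rewrite of_coordsK. Qed.

Lemma coords0 n : coords n 0 = 0.
Proof. by apply/rowP => j; rewrite !mxE cf0. Qed.

Definition opmx n n' (phi : F -> F) : 'M[K]_(npart n, npart n') :=
  \matrix_(i, j) cf (nthpart j) (phi (mon F (nthpart i))).

Lemma coords_op n n' (phi : {linear F -> F}) f : homog n f -> coords n' (phi f) =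
  coords n f *m opmx n n' phi.
Proof.
move=> /coordsK {1}<-; apply/rowP => j; rewrite !mxE linear_sum cf_sum.
by apply: eq_bigr => i _; rewrite linearZ cfZ !mxE.
Qed.

End Coordinates.

Section Jantzen.
Context {K : numFieldType} {F : fockSpace K}.
Implicit Types (f g : F) (c e x : K) (n k t : nat) (s : seq nat).

(** Among the terms of L_(-n) = 1/4 sum_i :b_i b_(-n-i):, only the two with b_0 involve the charge,
    and together they are b_0 b_(-n) / 2. *)
Lemma virop_shift c e i f : virop (c + e) (Negz i) f = virop c (Negz i) f + (e / 2%:R) *:
  pmul i f.
Proof.
elim/(@fock_ind K F): f => [|a f g IHf IHg|j f IHf].
- by rewrite !virop_vac /=; move: (\sum_(_ < _) _) => S; ffield.
- by rewrite !linearP /= IHf IHg; fring.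
have bC : heis (c + e) (Negz i + Negz j) f = heis c (Negz i + Negz j) f by [].
by rewrite !virop_pmul IHf bC linearD linearZ /= (pmulC j i); fring.
Qed.

Definition vword c s : F := foldr (fun i f => virop c (Negz i) f) vac s.

(* The coefficient of e^t in the word [s] of negative modes at charge [c + e]. *)
Fixpoint vwordc c s t : F :=
  if s is i :: s' then
    virop c (Negz i) (vwordc c s' t) + (if t is t'.+1 then 2%:R^-1 *:
      pmul i (vwordc c s' t') else 0)
  else if t is 0 then vac else 0.

Lemma vwordc0 c s : vwordc c s 0 = vword c s.
Proof. by elim: s => //= i s ->; rewrite addr0. Qed.

Lemma vwordc_gt c s t : (size s < t)%N -> vwordc c s t = 0.
Proof.
elim: s t => [|i s IHs] [|t] //= st.
by rewrite !IHs ?(ltnW st) // !linear0 addr0.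
Qed.

(** The top coefficient takes p_i / 2 from every letter, which makes the matrix of leading
    coefficients diagonal and the determinant nonzero. *)
Lemma vwordc_top c s : vwordc c s (size s) = 2%:R ^- size s *: mon F s.
Proof.
elim: s => [|i s IHs] /=; first by rewrite expr0 invr1 scale1r.
by rewrite vwordc_gt // linear0 add0r IHs linearZ /= pmul_mon scalerA exprS invfM.
Qed.

Lemma vword_shift c e s : vword (c + e) s = \sum_(t < (size s).+1) e ^+ t *: vwordc c s t.
Proof.
elim: s => [|i s IHs]; first by rewrite big_ord1 expr0 scale1r.
rewrite [LHS]/= virop_shift IHs !linear_sum /=.
rewrite [RHS](eq_bigr (fun t : 'I__ => e ^+ t *: virop c (Negz i) (vwordc c s t) +
   e ^+ t *: (if t : nat is t'.+1 then 2%:R^-1 *: pmul i (vwordc c s t') else 0))); last first.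
  by move=> t _; rewrite scalerDr.
rewrite big_split /=; congr (_ + _).
  rewrite [RHS]big_ord_recr /= vwordc_gt // linear0 scaler0 addr0.
  by apply: eq_bigr => t _; rewrite linearZ.
rewrite [RHS]big_ord_recl scaler0 add0r; apply: eq_bigr => t _.
by rewrite linearZ /= !scalerA /bump /= add1n exprS; congr (_ *: _); ring.
Qed.

Lemma homog_vwordc c s t : homog (lev s) (vwordc c s t).
Proof.
elim: s t => [|i s IHs] t.
  by case: t => [|t]; rewrite /homog /= ?degop_vac ?linear0 ?scaler0 ?scale0r.
rewrite /= (_ : lev (i :: s) = i.+1 + lev s)%N // /homog linearD /= degop_virop IHs linearZ /=.
rewrite NegzE mulrNz scaleNr opprK -pmulrn natrD scalerDl [_.+1%:R *: _ + _]addrC.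
case: t => [|t]; first by rewrite linear0 addr0; fring.
rewrite linearZ /= degop_pmul IHs linearZ /=; fring.
Qed.

(** At charge k the zero mode kills [vac], its value being h_(-k-1) = 0. Virasoro letters commute
    with e, and each of the t factors p_i costs one more power of e. *)
Lemma vpow_vwordc k s t : vpow t.+1 k%:Z (vwordc k%:R s t) = 0.
Proof.
elim: s t => [|i s IHs] t /=; last first.
  rewrite !linearD /=.
  have := vpow_virop t.+1 k (Negz i) (vwordc k%:R s t); rewrite /= -[k%:~R]/k%:R => ->.
  have := IHs t; rewrite /= => ->; rewrite linear0 add0r.
  case: t => [|t]; first by rewrite !linear0.
  have := vpow_pmul_eq0 i (IHs t); rewrite !linearZ /= => ->.
  by rewrite scaler0.
case: t => [|t]; last by rewrite !linear0.
by rewrite vertex_vac (_ : - _ = Negz k) //; lia.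
Qed.

Arguments vpow : simpl never.

Variable n : nat.
Local Notation N := (npart n).

Definition vword_pmx c : 'M[{poly K}]_N :=
  \matrix_(i, j) \poly_(t < (size (nthpart i)).+1) cf (nthpart j) (vwordc c (nthpart i) t).

Lemma coef_vword_pmx c t i j : (vword_pmx c i j)`_t = cf (nthpart j) (vwordc c (nthpart i) t).
Proof.
rewrite mxE coef_poly ltnS; case: leqP => // lt; by rewrite vwordc_gt ?cf0.
Qed.

Definition vword_det x : K := \det (\matrix_(i < N, j < N) cf (nthpart j)
  (vword x (nthpart i))).

Lemma det_vword_pmx c e : (\det (vword_pmx c)).[e] = vword_det (c + e).
Proof.
rewrite -horner_evalE -det_map_mx; congr (\det _); apply/matrixP => i j.
rewrite !mxE /= horner_evalE horner_poly vword_shift cf_sum.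
by apply: eq_bigr => t _; rewrite cfZ mulrC.
Qed.

Definition vword_dp : {poly K} := \det (vword_pmx 0).

Lemma vword_dpE x : vword_dp.[x] = vword_det x.
Proof. by rewrite /vword_dp det_vword_pmx add0r. Qed.

Lemma vword_dp_shift c : vword_dp = \det (vword_pmx c) \Po ('X - c%:P).
Proof.
apply: poly_ext => x; rewrite vword_dpE horner_comp det_vword_pmx hornerD hornerN hornerX
  hornerC.
by rewrite addrC subrK.
Qed.

Lemma vword_flip x s : vword (- x) s = flip (vword x s).
Proof. by elim: s => [|i s IHs] /=; rewrite ?flip_vac // IHs flip_virop. Qed.

(** [flip] turns words at charge x into words at charge -x and acts on coordinates by signs; a is
    the determinant of the sign matrix. *)
Lemma vword_detN : exists a, forall x, vword_det x = a * vword_det (- x).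
Proof.
pose d : 'rV[K]_N := \row_j (-1) ^+ size (nthpart j).
exists (\det (diag_mx d)) => x; rewrite mulrC -det_mulmx; congr (\det _); apply/matrixP => i j.
rewrite mul_mx_diag !mxE vword_flip cf_flip mulrC mulrA -exprD addnn -mul2n exprM sqrrN expr1n.
by rewrite expr1n mul1r.
Qed.

Lemma vword_dp_topc : topc vword_dp (\sum_i size (nthpart (n := n) i))
  (\prod_(i < N) 2%:R ^- size (nthpart i)).
Proof.
have := @det_topc _ _ (vword_pmx 0) (fun i => size (nthpart i)) _;
  set M := (X in topc _ _ (\det X)).
have -> : M = diag_mx (\row_i 2%:R ^- size (nthpart i)).
  apply/matrixP => i j; rewrite /M mxE coef_vword_pmx vwordc_top cfZ cf_mon nthpart_perm !mxE.
  by rewrite eq_sym; case: eqVneq => [->|]; rewrite ?mulr1 ?mulr1n ?mulr0 ?mulr0n.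
rewrite det_diag (eq_bigr (fun i => 2%:R ^- size (nthpart i))) => [|i _]; last by rewrite mxE.
by apply=> i j; rewrite mxE; apply: size_poly.
Qed.

Lemma vword_dp_neq0 : vword_dp != 0.
Proof.
have [_ topE] := vword_dp_topc; apply: contra_eq_neq topE => ->; rewrite coef0 eq_sym.
by apply/prodf_neq0 => i _; rewrite invr_eq0 expf_neq0 // pnatr_eq0.
Qed.

Lemma size_vword_dp : ((size vword_dp).-1 <= \sum_(j < n) \sum_(r < n) npart_sub n
  (r.+1 * j.+1))%N.
Proof.
have [sdp _] := vword_dp_topc; apply: leq_trans (sum_size_parts n).
rewrite (big_nth [::]) big_mkord; move: sdp; rewrite /nthpart; case: (size _) => //.
Qed.

Lemma vword_dp_mup_ge c m : 'X^m %| \det (vword_pmx c) -> (m <= mup c vword_dp)%N.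
Proof.
move=> /dvdpP[q qE]; rewrite mup_geq ?vword_dp_neq0 // (vword_dp_shift c) qE comp_polyM
  comp_Xn_poly.
exact: dvdp_mull.
Qed.

Lemma vword_dp_mupN_ge c m : 'X^m %| \det (vword_pmx c) -> (m <= mup (- c) vword_dp)%N.
Proof.
move=> /dvdpP[q qE]; rewrite mup_geq ?vword_dp_neq0 //.
have [a aE] := vword_detN.
have -> : vword_dp = a *: (vword_dp \Po - 'X).
  by apply: poly_ext => x; rewrite hornerZ horner_comp hornerN hornerX !vword_dpE aE.
rewrite (vword_dp_shift c) qE !comp_polyM comp_Xn_poly.
have -> : ('X - c%:P) ^+ m \Po - 'X = (-1) ^+ m *: ('X - (- c)%:P) ^+ m.
  apply: poly_ext => x; rewrite hornerZ horner_comp !horner_exp !hornerD !hornerN !hornerX.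
  by rewrite !hornerC -exprMn; congr (_ ^+ _); ring.
by rewrite -scalerAr scalerA -mul_polyC; do 2 apply: dvdp_mull.
Qed.

(* The flag for [det_flag] at charge [k]: [1%:M] stands for a zero target. *)
Definition kervpow_mx k (s : nat) : 'M[K]_N :=
  if (s.+1 * (s.+1 + k) <= n)%N then
    kermx (opmx n (n - s.+1 * (s.+1 + k)) (@vpow K F s.+1 k%:Z))
  else 1%:M.

Lemma homog_vpow k (s : nat) f : (s.+1 * (s.+1 + k) <= n)%N -> homog n f ->
  homog (n - s.+1 * (s.+1 + k)) (vpow s.+1 k%:Z f).
Proof.
move=> sn fn; rewrite /homog degop_vpow fn linearZ natrB // scalerBl; congr (_ - _ *: _).
by rewrite pmulrn; congr _%:~R; lia.
Qed.

(** As e^(s+1) is onto, the codimension of its kernel is the dimension of the target, which is zero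
    when the target degree is negative. *)
Lemma rank_kervpow_mx k (s : nat) : (N - \rank (kervpow_mx k s) =
  npart_sub n (s.+1 * (s.+1 + k)))%N.
Proof.
rewrite /kervpow_mx /npart_sub; case: ifP => sn; last by rewrite mxrank1 subnn.
rewrite mxrank_ker subKn ?rank_leq_row //; apply/eqP; rewrite -[_ == _]/(row_full _) -sub1mx.
apply/row_subP => j; set u := row j _.
have [|x xn xE] := @vpow_surj K F s.+1 k%:Z (n - s.+1 * (s.+1 + k))%N (of_coords u) isT.
  by rewrite -pmulrn; exact: homog_of_coords.
have xn' : homog n x by rewrite /homog xn pmulrn; congr (_%:~R *: _); lia.
by apply/submxP; exists (coords n x); rewrite -(coords_op _ _ xn') /= xE of_coordsK.
Qed.

Lemma sub_kervpow_mx k (s : nat) f : homog n f -> vpow s.+1 k%:Z f = 0 ->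
  (coords n f <= kervpow_mx k s)%MS.
Proof.
move=> fn f0; rewrite /kervpow_mx; case: ifP => _; last exact: submx1.
by apply/sub_kermxP; rewrite -coords_op //= f0 coords0.
Qed.

Lemma kervpow_mx_eq0 k (s : nat) f : homog n f -> (s.+1 * (s.+1 + k) <= n)%N ->
  (coords n f <= kervpow_mx k s)%MS -> vpow s.+1 k%:Z f = 0.
Proof.
move=> fn sn; rewrite /kervpow_mx sn => /sub_kermxP; rewrite -coords_op // => f0.
by apply: (homog_eq (homog_vpow sn fn) (homog0 _)); rewrite f0 coords0.
Qed.

Lemma kervpow_mx_incr k (s : nat) : (kervpow_mx k s <= kervpow_mx k s.+1)%MS.
Proof.
rewrite {2}/kervpow_mx; case: ifP => sn; last exact: submx1.
have sn' : (s.+1 * (s.+1 + k) <= n)%N by apply: leq_trans sn; apply: leq_mul; lia.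
have := sub_kervpow_mx (k := k) (s := s.+1); rewrite /kervpow_mx sn => sU.
apply/row_subP => i; rewrite -(of_coordsK (F := F) (row i _)); apply: sU;
  first exact: homog_of_coords.
apply: (@ker_vpow_incr _ _ s.+1) => //.
by apply: kervpow_mx_eq0 => //; [exact: homog_of_coords|rewrite of_coordsK row_sub].
Qed.

Lemma row_coefp_vword_pmx c t i : row i (map_mx (coefp t) (vword_pmx c)) =
  coords n (vwordc c (nthpart i) t).
Proof. by apply/rowP => j; rewrite mxE mxE [RHS]mxE; apply: coef_vword_pmx. Qed.

Lemma homog_vwordc_nthpart c i t : homog n (vwordc c (nthpart (n := n) i) t).
Proof. by rewrite -{1}(lev_nthpart i); apply: homog_vwordc. Qed.

Lemma coefp_vword_pmx_ker k t (s : nat) : (t <= s)%N ->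
  (map_mx (coefp t) (vword_pmx k%:R) <= kervpow_mx k s)%MS.
Proof.
move=> ts; apply/row_subP => i; rewrite row_coefp_vword_pmx; apply: sub_kervpow_mx;
  first exact: homog_vwordc_nthpart.
by apply: (@ker_vpow_incr _ _ t.+1); [|exact: vpow_vwordc].
Qed.

Lemma dvdp_vmult k : 'X^(vmult n k) %| \det (vword_pmx k%:R).
Proof.
rewrite /vmult (eq_bigr (fun s : 'I_n => N - \rank (kervpow_mx k s))%N) => [|s _].
  by apply: det_flag => [s _|t s ts _]; [exact: kervpow_mx_incr|exact: coefp_vword_pmx_ker].
by rewrite rank_kervpow_mx.
Qed.

Definition words_mx k : 'M[K]_N := \matrix_i coords n (vword k%:R (nthpart i)).

Lemma words_mxE k : words_mx k = map_mx (coefp 0) (vword_pmx k%:R).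
Proof. by apply/row_matrixP => i; rewrite rowK row_coefp_vword_pmx vwordc0. Qed.

(** The first step of the flag only has to contain the constant coefficients of the rows, which are
    the words at charge k. Their span in place of ker e brings the unknown rank into the bound. *)
Lemma dvdp_mult_words k :
  'X^(N - \rank (words_mx k) + \sum_(s < n) npart_sub n (s.+2 * (s.+2 + k))) %| \det
    (vword_pmx k%:R).
Proof.
pose U (s : nat) := if s is 0 then words_mx k else kervpow_mx k s.
have := @det_flag _ _ n.+1 (vword_pmx k%:R) U; rewrite big_ord_recl.
rewrite (eq_bigr (fun s : 'I_n => npart_sub n (s.+2 * (s.+2 + k)))) => [|s _];
  last exact: rank_kervpow_mx.
apply=> [[|s] _|t [|s]]; rewrite /U.
- by rewrite words_mxE; apply: coefp_vword_pmx_ker.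
- exact: kervpow_mx_incr.
- by rewrite leqn0 => /eqP -> _; rewrite words_mxE.
- by move=> ts _; apply: coefp_vword_pmx_ker.
Qed.

Lemma mup_vword_dp k : mup k%:R vword_dp = vmult n k.
Proof.
(* The list of roots must contain k even for k >= n, where [vmult] is 0; the root 0 is listed
   once. *)
pose m := maxn n k.+1; pose rs : seq K :=
  [seq i%:R | i <- index_iota 0 m] ++ [seq - i%:R | i <- index_iota 1 m].
have urs : uniq rs.
  have natI : injective (fun i : nat => i%:R : K) by move=> i j /eqP; rewrite eqr_nat => /eqP.
  rewrite cat_uniq !map_inj_uniq ?iota_uniq //; last by move=> i j /oppr_inj/natI.
  rewrite andbT /=; apply/hasPn => _ /mapP[i i1 ->]; apply/mapP => -[j _ /eqP].
  rewrite eq_sym -addr_eq0 -natrD pnatr_eq0 addn_eq0 => /andP[_ /eqP i0].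
  by move: i1; rewrite i0 mem_index_iota.
have := sum_mup_le vword_dp_neq0 urs; rewrite big_cat !big_map /= => mup_le.
have ge i : (vmult n i <= mup i%:R vword_dp)%N by apply/vword_dp_mup_ge/dvdp_vmult.
have geN i : (vmult n i <= mup (- i%:R) vword_dp)%N by apply/vword_dp_mupN_ge/dvdp_vmult.
have nm : (n <= m)%N by apply: leq_maxl.
have km : (k < m)%N by apply: leq_maxr.
have deg_le := leq_trans mup_le (leq_trans size_vword_dp (sum_npart_sub_le n)).
have extend : (\sum_(i < n) vmult n i <= \sum_(0 <= i < m) vmult n i)%N.
  by rewrite -(big_mkord predT (vmult n)) [leqRHS](big_cat_nat (n := n)) //= leq_addr.
have extend1 : (\sum_(1 <= i < n) vmult n i <= \sum_(1 <= i < m) vmult n i)%N.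
  case: (n) nm => [|n'] n'm; first by rewrite big_geq.
  by rewrite [leqRHS](big_cat_nat (n := n'.+1)) //= leq_addr.
have le1 : (\sum_(1 <= i < m) vmult n i <= \sum_(1 <= i < m) mup (- i%:R) vword_dp)%N by apply:
  leq_sum.
have kin : k \in index_iota 0 m by rewrite mem_index_iota.
move: deg_le extend; rewrite !(big_rem _ kin) /=.
have le0 : (\sum_(i <- rem k (index_iota 0 m)) vmult n i <=
  \sum_(i <- rem k (index_iota 0 m)) mup i%:R vword_dp)%N by apply: leq_sum.
move: le0 le1 extend1 (ge k).
move: (\sum_(i <- rem k _) vmult n i)%N (\sum_(i <- rem k _) mup i%:R vword_dp)%N => a1 a2.
move: (\sum_(1 <= i < m) vmult n i)%N (\sum_(1 <= i < m) mup (- i%:R) vword_dp)%N => a3 a4.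
move: (\sum_(1 <= i < n) vmult n i)%N (\sum_(i < n) vmult n i)%N => a5 a6.
by move: (mup _ _) (vmult n k) => a7 a8; lia.
Qed.

(** The order at k being exact, [dvdp_mult_words] bounds the codimension of the span by that of ker
    e, and the words lie in ker e. *)
Theorem rank_words k : (\rank (words_mx k) = N - npart_sub n k.+1)%N.
Proof.
have mE : (vmult n k = npart_sub n k.+1 + \sum_(s < n) npart_sub n (s.+2 * (s.+2 + k)))%N.
  have -> : vmult n k = (\sum_(s < n.+1) npart_sub n (s.+1 * (s.+1 + k)))%N.
    rewrite big_ord_recr /= [npart_sub _ (n.+1 * _)]/npart_sub ifF ?addn0 //.
    by apply/negbTE; rewrite -ltnNge; nia.
  by rewrite big_ord_recl /= mul1n add1n.
have := vword_dp_mup_ge (dvdp_mult_words k); rewrite mup_vword_dp mE leq_add2r => le1.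
have : (words_mx k <= kervpow_mx k 0)%MS by rewrite words_mxE; apply: coefp_vword_pmx_ker.
move=> /mxrankS; have := rank_kervpow_mx k 0; rewrite mul1n add1n => <-.
have := rank_leq_row (words_mx k); have := rank_leq_row (kervpow_mx k 0).
have := rank_kervpow_mx k 0; rewrite mul1n add1n; lia.
Qed.

Theorem ker_vertex0_words k f : homog n f -> vertex (k%:Z + 1) f = 0 ->
  (coords n f <= words_mx k)%MS.
Proof.
move=> fn f0; apply: submx_trans (sub_kervpow_mx (k := k) (s := 0) fn f0) _.
have sub : (words_mx k <= kervpow_mx k 0)%MS by rewrite words_mxE; apply: coefp_vword_pmx_ker.
have := mxrank_leqif_sup sub => -[_ <-]; rewrite rank_words.
have := rank_leq_row (kervpow_mx k 0); have := rank_kervpow_mx k 0; rewrite mul1n add1n => <-;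
  lia.
Qed.

End Jantzen.

(** * Modules generated by a highest-weight vector *)

Section Eigen.
Local Open Scope classical_set_scope.
Context {K : numFieldType} {V : lmodType K}.

Lemma subspace0 : subspace [set (0 : V)].
Proof. by split=> // a x y -> ->; rewrite scaler0 addr0. Qed.

Lemma subspaceB (S : set V) x y : subspace S -> S x -> S y -> S (x - y).
Proof. by move=> [_ SD] Sx Sy; rewrite addrC -scaleN1r; apply: SD. Qed.

Lemma subspaceZ (S : set V) a x : subspace S -> S x -> S (a *: x).
Proof. by move=> [S0 SD] Sx; rewrite -[_ *: _]addr0; apply: SD. Qed.

Variables (T : {linear V -> V}) (h : K).
Local Notation eigen j x := (T x = (h + j%:R) *: x).

(** T - (h + N) kills the last component and multiplies the j-th one by j - N, which is nonzero. *)
Lemma eigen_sep (S : set V) N (y : nat -> V) : subspace S ->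
  (forall x, S x -> S (T x)) -> (forall j, eigen j (y j)) ->
  S (\sum_(j < N) y j) -> forall j, (j < N)%N -> S (y j).
Proof.
move=> SS ST; elim: N y => // N IH y yE Sy.
have yj j : (j < N)%N -> S (y j).
  move=> jN; have jN0 : (j%:R - N%:R : K) != 0 by rewrite subr_eq0 eqr_nat neq_ltn jN.
  rewrite -[y j](scalerK jN0); apply: subspaceZ => //.
  apply: (IH (fun j => (j%:R - N%:R) *: y j)) => // [l|].
    by rewrite linearZ /= yE !scalerA mulrC.
  have -> : \sum_(l < N) (l%:R - N%:R) *: y l =
      T (\sum_(l < N.+1) y l) - (h + N%:R) *: \sum_(l < N.+1) y l.
    rewrite linear_sum scaler_sumr -sumrB big_ord_recr /= yE subrr addr0.
    by apply: eq_bigr => l _; rewrite yE -scalerBl; congr (_ *: _); ring.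
  by apply: subspaceB; [|exact: ST|exact: subspaceZ].
move=> j; rewrite ltnS leq_eqVlt => /orP[/eqP ->|/yj //].
have -> : y N = \sum_(l < N.+1) y l - \sum_(l < N) y l by rewrite big_ord_recr /=
  addrAC subrr add0r.
apply: subspaceB => //; elim/big_rec: _ => [|l x _ Sx]; first by case: SS.
by rewrite -[y l]scale1r; case: SS => _; apply=> //; apply: yj.
Qed.

Lemma eigen_comp n N (y : nat -> V) x : eigen n x -> (forall j, eigen j (y j)) ->
  x = \sum_(j < N) y j -> x = if (n < N)%N then y n else 0.
Proof.
move=> xE yE xy; pose M := maxn N n.+1.
(* z is the difference of two decompositions of x, both padded to length M. *)
pose z j := (if (j < N)%N then y j else 0) - (if j == n then x else 0).
have z0 : \sum_(j < M) z j = 0.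
  rewrite sumrB -big_mkcond /= -(big_ord_widen M y) ?leq_maxl // -xy.
  have nM : (n < M)%N by rewrite leq_maxr.
  rewrite (bigD1 (Ordinal nM)) //= eqxx big1 ?addr0 ?subrr // => i.
  by rewrite -val_eqE /= => /negbTE ->.
have zE j : eigen j (z j).
  rewrite linearB /= scalerBr; congr (_ - _).
    by case: ifP => _; rewrite ?yE // linear0 scaler0.
  by case: eqVneq => [->|_]; rewrite ?xE // linear0 scaler0.
have T0 y0 : [set 0] y0 -> [set 0] (T y0) by move=> ->; rewrite /= linear0.
have := eigen_sep subspace0 T0 zE z0 (leq_maxr N n.+1).
by rewrite /z eqxx /= => /eqP; rewrite subr_eq0 => /eqP.
Qed.

End Eigen.

Section Words.
Local Open Scope classical_set_scope.
Context {K : numFieldType} {M : virModule K} {h : K} {v : M}.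
Hypothesis hv : hw_vector 1 h v.
Hypothesis gen : forall S : set M, vir_submodule S -> S v -> S = setT.

Definition ngword (s : seq nat) : M := foldr (fun i => virL M (Negz i)) v s.

(** With a list of terms, the part of a given level is obtained by filtering. *)
Definition ngcomb (l : seq (K * seq nat)) : M := \sum_(x <- l) x.1 *: ngword x.2.

Lemma virL0_L n x j : virL M 0 x = (h + j) *: x ->
  virL M 0 (virL M n x) = (h + (j - n%:~R)) *: virL M n x.
Proof.
have z0 : ((0 : int) ^+ 3 - 0)%:~R / 12%:R = 0 :> K by rewrite expr0n subrr mul0r.
move=> xE; have := virLL 0 n x; rewrite /vir_bracket z0 scale0r if_same addr0 !add0r.
move/eqP; rewrite subr_eq => /eqP ->; rewrite xE linearZ /= -scalerDl rmorphN.
by congr (_ *: _); ring.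
Qed.

Lemma virL0_ngword s : virL M 0 (ngword s) = (h + (lev s)%:R) *: ngword s.
Proof.
elim: s => [|i s IHs]; first by case: hv => _ -> _; rewrite addr0.
rewrite /= (virL0_L _ IHs) NegzE rmorphN opprK /= -pmulrn.
by rewrite (_ : lev (i :: s) = i.+1 + lev s)%N // natrD (addrC i.+1%:R).
Qed.

Lemma virC_ngword s : virC M (ngword s) = ngword s.
Proof.
elim: s => [|i s IHs] /=; first by case: hv => _ _ ->; rewrite scale1r.
by rewrite virLC IHs.
Qed.

(** An operator L_n is commuted past the letters until it meets v. The letters stay in arbitrary
    order, so the bracket term is the induction hypothesis at another index. *)
Lemma ngcomb_span x : exists l, x = ngcomb l.
Proof.
pose S : set M := [set x | exists l, x = ngcomb l].
have S0 : S 0 by exists [::]; rewrite /ngcomb big_nil.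
have SD a y z : S y -> S z -> S (a *: y + z).
  move=> [l ->] [l' ->]; exists ([seq (a * x.1, x.2) | x <- l] ++ l').
  rewrite /ngcomb big_cat big_map scaler_sumr; congr (_ + _).
  by apply: eq_bigr => i _; rewrite scalerA.
have SZ a y : S y -> S (a *: y) by move=> Sy; rewrite -[_ *: _]addr0; apply: SD.
have SA y z : S y -> S z -> S (y + z) by move=> Sy Sz; rewrite -[y]scale1r; apply: SD.
have Snw s : S (ngword s) by exists [:: (1, s)]; rewrite /ngcomb big_seq1 scale1r.
have Slin (phi : {linear M -> M}) : (forall s, S (phi (ngword s))) -> forall y, S y ->
  S (phi y).
  move=> Sphi y [l ->]; rewrite /ngcomb linear_sum; elim/big_rec: _ => // x' z _ Sz.
  by rewrite linearZ; apply: SD.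
have SN i y : S y -> S (virL M (Negz i) y).
  by apply: Slin => s; apply: (Snw (i :: s)).
have SL s n : S (virL M n (ngword s)).
  elim: s n => [|i s IHs] n.
    have [hpos h0 _] := hv; case: n => [[|n]|i]; last exact: (Snw [:: i]).
      by rewrite /= h0; apply: SZ; apply: (Snw [::]).
    by rewrite /= hpos.
  have := virLL n (Negz i) (ngword s); rewrite /vir_bracket => /eqP.
  rewrite subr_eq => /eqP /= ->; apply: (SA); last exact: SN.
  apply: SD => //; case: ifP => // _; rewrite virC_ngword; exact: SZ.
suff : S = setT by move=> ST; have : S x by rewrite ST.
apply: gen; last exact: (Snw [::]).
split; [by split|by move=> n y; apply: Slin => s; apply: SL|].
by apply: Slin => s; rewrite virC_ngword.
Qed.

Definition ngspace j x := exists2 l, x = ngcomb l & all (fun y => lev y.2 == j) l.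

Lemma ngspace_eigen j x : ngspace j x -> virL M 0 x = (h + j%:R) *: x.
Proof.
move=> [l -> lj]; rewrite /ngcomb linear_sum scaler_sumr;
  apply: eq_big_seq => y /(allP lj)/eqP yj.
by rewrite linearZ /= virL0_ngword yj !scalerA mulrC.
Qed.

Lemma ngspace_dec x : exists N (y : nat -> M), (forall j, ngspace j (y j)) /\ x =
  \sum_(j < N) y j.
Proof.
have [l ->] := ngcomb_span x.
pose N := (\max_(y <- l) lev y.2).+1.
exists N, (fun j => ngcomb [seq y <- l | lev y.2 == j]); split=> [j|].
  by exists [seq y <- l | lev y.2 == j]; rewrite ?filter_all.
rewrite /ngcomb; under [RHS]eq_bigr => j _ do rewrite big_filter big_mkcond.
rewrite exchange_big /=; apply: eq_big_seq => y yl.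
have yN : (lev y.2 < N)%N by rewrite ltnS (leq_bigmax_seq
  (F := fun y : K * seq nat => lev y.2)).
rewrite (bigD1 (Ordinal yN)) //= eqxx big1 ?addr0 // => i.
by rewrite -val_eqE /= eq_sym => /negbTE ->.
Qed.

Lemma ngspace_eigenE n x : virL M 0 x = (h + n%:R) *: x -> ngspace n x.
Proof.
move=> xE; have [N [y [yw xy]]] := ngspace_dec x.
have := eigen_comp xE (fun j => ngspace_eigen (yw j)) xy; case: ifP => _ -> //.
by exists [::]; rewrite ?/ngcomb ?big_nil.
Qed.

Lemma ngspace0 x : virL M 0 x = h *: x -> exists c, x = c *: v.
Proof.
move=> xE; have [|l -> l0] := @ngspace_eigenE 0 x; first by rewrite addr0.
exists (\sum_(y <- l) y.1); rewrite scaler_suml; apply: eq_big_seq => y /(allP l0).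
by case: (y.2).
Qed.

End Words.

Arguments ngword {K M} v s.
Arguments ngcomb {K M} v l.
Arguments ngspace {K M} v j x.

(** * Comparison of the irreducible quotient with ker e *)

Section WordsMx.
Context {K : numFieldType} {F : fockSpace K}.

Lemma homog_vword c s : homog (lev s) (vword c s : F).
Proof. by rewrite -vwordc0; apply: homog_vwordc. Qed.

Lemma homog_words n k (a : 'rV[K]_(npart n)) : homog n (\sum_i a 0 i *:
  (vword k (nthpart i) : F)).
Proof. by apply: homog_sum => i _; rewrite -{1}(lev_nthpart i); apply: homog_vword. Qed.

Lemma coords_words n k (a : 'rV[K]_(npart n)) :
  coords n (\sum_i a 0 i *: (vword k%:R (nthpart i) : F)) = a *m @words_mx K F n k.
Proof.
apply/rowP => j; rewrite !mxE cf_sum; apply: eq_bigr => i _.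
by rewrite cfZ !mxE.
Qed.

(** The words span ker e, on which the contravariant form is nondegenerate. *)
Lemma ker_vertex0_cform_eq0 n k (w : F) : homog n w -> vertex (k%:Z + 1) w = 0 ->
  (forall s, lev s = n -> cform (vword k%:R s) w = 0) -> w = 0.
Proof.
move=> wn ew w0; apply: (ker_vertex0_nondeg (k := k) (z := n)) => // x xn ex.
have /submxP[a xa] := ker_vertex0_words xn ex.
have -> : x = \sum_i a 0 i *: vword k%:R (nthpart i).
  by apply: (homog_eq xn); [exact: homog_words|rewrite coords_words].
elim/big_rec: _ => [|i y _ y0]; first exact: cform0l.
by rewrite cformDl y0 w0 ?lev_nthpart // mulr0 addr0.
Qed.

End WordsMx.

Section FockModule.
Context {K : numFieldType} (F : fockSpace K) (c : K).

Lemma virop0_degop f : virop c 0 f = degop f + (c ^+ 2 / 4%:R) *: (f : F).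
Proof.
elim/(@fock_ind K F): f => [|a f g IHf IHg|j f IHf].
- by rewrite virop_vac degop_vac add0r.
- by rewrite !linearP /= IHf IHg; fring.
have b0 : heis c (0 + Negz j) f = pmul j f by rewrite add0r.
by rewrite virop_pmul b0 degop_pmul IHf linearD linearZ /=; fring.
Qed.

Lemma fock_virLL m n x : virop c m (virop c n x) - virop c n (virop c m x) =
  vir_bracket (virop c) idfun m n (x : F).
Proof. by rewrite virop_comm /vir_bracket; case: ifP; rewrite ?scale0r. Qed.

Definition fock_vir : virModule K :=
  @VirModule K F (fun n => virop c n) idfun fock_virLL (fun n x => erefl).

Lemma fock_hw : hw_vector 1 (c ^+ 2 / 4%:R) (vac : fock_vir).
Proof.
by split=> [[[|n]|n] // _| |]; rewrite /= ?virop_vac ?scale1r.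
Qed.

End FockModule.

Section Character.
Local Open Scope classical_set_scope.
Context {K : numFieldType} (F : fockSpace K) (k : nat) (V : virModule K).
Local Notation h := ((k%:R / 2%:R) ^+ 2 : K).
Local Notation M := (verma 1 h).
Local Notation v := (verma_v 1 h).
Local Notation wmx n := (@words_mx K F n k).
Hypothesis Virr : vir_irreducible V.
Variable f : {linear M -> V}.
Hypothesis f_hom : vir_hom f.
Hypothesis f_surj : set_surj setT setT f.
Variable g : {linear M -> fock_vir F k%:R}.
Hypothesis g_hom : vir_hom g.
Hypothesis g_v : g v = vac.

Let hv : hw_vector 1 h v := verma_v_hw 1 h.
Let gen S := @verma_generated K 1 h S.

Lemma hw_image_neq0 : f v <> 0.
Proof.
move=> fv0; have [[x x0] _] := Virr.
have kerf : vir_submodule [set u : M | f u = 0].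
  case: f_hom => fL fC; split; first split.
  - exact: linear0.
  - by move=> a u w /= fu fw; rewrite linearP fu fw scaler0 addr0.
  - by move=> n u /= fu; rewrite fL fu linear0.
  - by move=> u /= fu; rewrite fC fu linear0.
have [u _ ux] := f_surj (Logic.I : setT x).
have : [set u : M | f u = 0] u by rewrite (gen kerf fv0).
by rewrite /= ux => /x0.
Qed.

Lemma g_ngword s : g (ngword v s) = vword k%:R s :> F.
Proof.
by elim: s => //= i s IHs; case: g_hom => gL _; rewrite gL IHs.
Qed.

Lemma vertex0_g u : vertex (k%:Z + 1) (g u : F) = 0.
Proof.
case: g_hom => gL gC.
pose S : set M := [set u | vertex (k%:Z + 1) (g u : F) = 0].
suff : S = setT by move=> ST; have : S u by rewrite ST.
apply: gen; last first.
  by rewrite /S /= g_v vertex_vac (_ : - _ = Negz k) //; lia.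
rewrite /S; split; first split.
- by rewrite /= !linear0.
- by move=> a x y /= ex ey; rewrite linearP /= linearP /= ex ey scaler0 addr0.
- move=> n x /= ex; rewrite gL /=; have := vpow_virop 1 k%:Z n (g x : F).
  by rewrite /= ex linear0.
- by move=> x /= ex; rewrite gC.
Qed.

Lemma homog_g j u : virL M 0 u = (h + j%:R) *: u -> homog j (g u : F).
Proof.
move=> /(congr1 g); case: g_hom => gL _; rewrite gL linearZ /= virop0_degop => e.
rewrite /homog -[degop _](addrK ((k%:R ^+ 2 / 4%:R) *: (g u : F))) e -scalerBl.
by congr (_ *: _); field.
Qed.

(** The adjoint of the word s of negative modes; [foldl] reverses the order of the operators. *)
Definition raise (W : virModule K) (s : seq nat) (x : W) : W :=
  foldl (fun y i => virL W (Posz i.+1) y) x s.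

Lemma cform_raise s x : cform (vword k%:R s) x = vcf (@raise (fock_vir F k%:R) s x : F).
Proof.
elim: s x => [|i s IHs] x; first by rewrite cform_vac.
by rewrite [vword _ _]/= (_ : Negz i = - (i.+1%:Z)) // cform_virop // IHs.
Qed.

Lemma g_raise s u : g (raise s u) = raise s (g u).
Proof. by elim: s u => //= i s IHs u; case: g_hom => gL _; rewrite IHs gL. Qed.

Lemma f_raise s u : f u = 0 -> f (raise s u) = 0.
Proof.
elim: s u => //= i s IHs u fu; apply: IHs.
by case: f_hom => fL _; rewrite fL fu linear0.
Qed.

Lemma virL0_raise s u : virL M 0 u = (h + (lev s)%:R) *: u -> virL M 0 (raise s u) = h *:
  raise s u.
Proof.
elim: s u => [|i s IHs] u uE; first by rewrite uE addr0.
apply: (IHs (virL M i.+1 u)); rewrite (virL0_L i.+1 uE); congr (_ *: _).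
rewrite (_ : lev (i :: s) = i.+1 + lev s)%N // natrD -pmulrn; ring.
Qed.

Lemma kerf_stable x : f x = 0 -> f (virL M 0 x) = 0.
Proof. by case: f_hom => fL _ fx; rewrite fL fx linear0. Qed.

Lemma ker_subspace (W : lmodType K) (phi : {linear M -> W}) : subspace [set u | phi u = 0].
Proof.
split=> [|a x y /= px py]; first exact: linear0.
by rewrite linearP px py scaler0 addr0.
Qed.

(** Pairing a component of g u with a word amounts to raising it to the top degree, where the Verma
    module is the line of v. The multiple of v obtained there lies in the kernel of f, so it is 0,
    and nondegeneracy applies. *)
Lemma kerf_g u : f u = 0 -> g u = 0.
Proof.
have [N [y [yw ->]]] := ngspace_dec hv gen u => fu.
have ye j : virL M 0 (y j) = (h + j%:R) *: y j by apply: (ngspace_eigen hv (yw j)).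
have fy := eigen_sep (ker_subspace f) kerf_stable ye fu.
rewrite linear_sum big1 // => -[j jN] _ /=.
apply: (ker_vertex0_cform_eq0 (homog_g (ye j)) (vertex0_g _)) => s sj.
rewrite cform_raise -g_raise.
have [|c cE] := ngspace0 hv gen (x := raise s (y j)); first by apply: virL0_raise;
  rewrite sj ye.
have : c *: f v = 0 by rewrite -linearZ -cE f_raise //; apply: fy.
move/eqP; rewrite scaler_eq0 => /orP[/eqP c0|/eqP/hw_image_neq0 //].
by rewrite cE c0 scale0r linear0 vcf0.
Qed.

(** The image of ker g under f is a submodule of V. If it were V, some u' in ker g would have f u' =
    f v; then u' - v lies in ker f, hence in ker g, which contradicts g v = [vac]. *)
Lemma kerg_f u : g u = 0 -> f u = 0.
Proof.
move=> gu; have [_ /(_ [set x | exists2 u, g u = 0 & f u = x])[]] := Virr.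
- case: f_hom g_hom => fL fC [gL gC]; split; first split.
  + by exists 0; rewrite linear0.
  + move=> a _ _ [x gx <-] [y gy <-]; exists (a *: x + y); last by rewrite linearP.
    by rewrite linearP gx gy scaler0 addr0.
  + by move=> n _ [x gx <-]; exists (virL M n x); rewrite ?fL // gL gx linear0.
  + by move=> _ [x gx <-]; exists (virC M x); rewrite ?fC // gC gx linear0.
- by move=> S0; have : [set 0] (f u) by rewrite -S0; exists u.
move=> ST; have [u' gu' fu'] : exists2 u', g u' = 0 & f u' = f v.
  by have : setT (f v) by []; rewrite -ST.
have := @kerf_g (u' - v); rewrite !linearB /= fu' subrr gu' g_v sub0r => /(_ erefl).
move=> /eqP; rewrite oppr_eq0 => /eqP/(congr1 (@vcf K F)).
by rewrite vcf_vac vcf0 => /eqP; rewrite oner_eq0.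
Qed.

Definition chr_dim n := \rank (wmx n).

(** [pinvmx] writes a basis of the row space as combinations of words. The same combinations in the
    Verma module are mapped by f; as f and g have the same kernel, independence and spanning pass
    from the Fock space to V. *)
Definition chr_basis n (i : 'I_(chr_dim n)) : V :=
  f (\sum_j (row_base (wmx n) *m pinvmx (wmx n)) i j *: ngword v (nthpart j)).

Lemma f_eigen n u : virL M 0 u = (h + n%:R) *: u -> virL V 0 (f u) = (h + n%:R) *: f u.
Proof. by case: f_hom => fL _ uE; rewrite -fL uE linearZ. Qed.

Lemma comb_eigen n (a : 'I_(npart n) -> K) :
  virL M 0 (\sum_j a j *: ngword v (nthpart j)) = (h + n%:R) *: \sum_j a j *:
    ngword v (nthpart j).
Proof.
rewrite linear_sum scaler_sumr; apply: eq_bigr => j _.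
by rewrite linearZ /= (virL0_ngword hv) lev_nthpart !scalerA; congr (_ *: _); exact: mulrC.
Qed.

Lemma coords_g_comb n (a : 'rV[K]_(npart n)) :
  coords n (g (\sum_j a 0 j *: ngword v (nthpart j)) : F) = a *m wmx n.
Proof.
rewrite -(coords_words (F := F)); congr (coords n _); rewrite linear_sum.
by apply: eq_bigr => j _; rewrite linearZ /= g_ngword.
Qed.

Lemma f_eq u u' : g u = g u' -> f u = f u'.
Proof.
by move=> guu; apply/eqP; rewrite -subr_eq0 -linearB; apply/eqP/kerg_f;
  rewrite linearB guu subrr.
Qed.

Lemma chr_lincomb n (a : 'I_(chr_dim n) -> K) :
  let comb := (\row_i a i) *m (row_base (wmx n) *m pinvmx (wmx n)) in
  \sum_i a i *: chr_basis i = f (\sum_j comb 0 j *: ngword v (nthpart j)) /\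
  comb *m wmx n = (\row_i a i) *m row_base (wmx n).
Proof.
move=> comb; split; last by rewrite /comb -mulmxA mulmxKpV // eq_row_base.
rewrite /chr_basis; under eq_bigr => i _ do rewrite -linearZ /=.
rewrite -linear_sum; congr (f _); under eq_bigr => i _ do rewrite scaler_sumr.
rewrite exchange_big; apply: eq_bigr => j _ /=; rewrite mxE scaler_suml.
by apply: eq_bigr => i _; rewrite scalerA !mxE.
Qed.

Lemma chr_has_dim n :
  has_dim [set x : V | virL V 0 x = (h + n%:R) *: x] (chr_dim n).
Proof.
exists (@chr_basis n); split=> [a|].
  have [-> combE] := chr_lincomb a; move/kerf_g => gb.
  have := coords_g_comb ((\row_i a i) *m (row_base (wmx n) *m pinvmx (wmx n))).
  rewrite gb coords0 combE => /esym/eqP; rewrite mulmx_free_eq0 ?row_base_free // => /eqP/rowP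
    a0 i.
  by have := a0 i; rewrite !mxE.
apply/seteqP; split=> x /=; last first.
  by move=> [a ->]; have [-> _] := chr_lincomb a; apply/f_eigen/comb_eigen.
move=> xE; have [u _ ux] := f_surj (Logic.I : setT x).
have [N [y [yw uy]]] := ngspace_dec hv gen u.
have ye j : virL M 0 (y j) = (h + j%:R) *: y j by apply: (ngspace_eigen hv (yw j)).
(* The preimage u of x can be replaced by its component of degree n. *)
have := eigen_comp (y := fun j => f (y j)) (N := N) xE (fun j => f_eigen (ye j)).
rewrite -ux uy linear_sum => /(_ erefl).
pose z := if (n < N)%N then y n else 0.
have ze : virL M 0 z = (h + n%:R) *: z.
  by rewrite /z; case: ifP => _; rewrite ?ye // linear0 scaler0.
have -> : (if (n < N)%N then f (y n) else 0) = f z by rewrite /z; case: ifP; rewrite ?linear0.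
have := ker_vertex0_words (homog_g ze) (vertex0_g z);
  rewrite -(eq_row_base (wmx n)) => /submxP[a aE] ->.
exists (fun i => a 0 i); have [-> combE] := chr_lincomb (fun i => a 0 i); apply: f_eq.
have ra : \row_i a 0 i = a by apply/rowP => i; rewrite mxE.
apply: (homog_eq (homog_g ze)); first exact/homog_g/comb_eigen.
by rewrite coords_g_comb combE ra.
Qed.

Lemma chr_direct_sum : direct_sum (fun n => [set x : V | virL V 0 x = (h + n%:R) *: x]).
Proof.
split.
- move=> n; split=> [|a x y /= xE yE]; first by rewrite /= linear0 scaler0.
  by rewrite linearP xE yE scalerDr !scalerA mulrC.
- move=> x; have [u _ ux] := f_surj (Logic.I : setT x).
  have [N [y [yw uy]]] := ngspace_dec hv gen u.
  exists N, (fun j => f (y j)); split; last by rewrite -ux uy linear_sum.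
  by move=> j; apply/f_eigen/(ngspace_eigen hv)/yw.
move=> N y yE y0; apply: (eigen_sep (T := virL V 0) (S := [set 0]) subspace0 _ yE y0).
by move=> _ ->; exact: linear0.
Qed.

Lemma chr_dimE n : ((chr_dim n)%:Z = ps_phi n - (if (k < n)%N then ps_phi (n - k.+1) else 0))%R.
Proof.
rewrite /chr_dim rank_words !ps_phi_npart -subzn; last first.
  by have := rank_kervpow_mx (F := F) n k 0; rewrite mul1n add1n => <-; apply: leq_subr.
by congr (_ - _); rewrite /npart_sub; case: ifP.
Qed.

Lemma qseries_out (a : nat -> int) (t : K) : (forall n, n%:R <> t) -> qseries a t = 0.
Proof.
move=> nt; rewrite /qseries (_ : [set n : nat | n%:R = t] = set0) ?fsbig_set0 //.
by apply/seteqP; split=> // n /nt.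
Qed.

Theorem virr_character :
  has_character V (qmul (qpow h - qpow ((k%:R / 2%:R + 1) ^+ 2)) (qseries ps_phi)).
Proof.
exists h, (fun n => [set x : V | virL V 0 x = (h + n%:R) *: x]), chr_dim; split=> //.
- exact: chr_direct_sum.
- exact: chr_has_dim.
apply/funext => t; rewrite qpowBM qpowM.
(* For m = k/2 one has (m + 1)^2 - m^2 = k + 1, the degree at which the dimensions first drop. *)
have -> : t - (k%:R / 2%:R + 1) ^+ 2 = (t - h) - k.+1%:R by rewrite -natr1; field.
have K0 := pchar_num K; move: (t - h) => s.
have [[n ns]|sn] := pselect (exists n : nat, n%:R = s); last first.
  rewrite !qseries_out ?subr0 // => n ns; apply: sn;
    [by exists n|exists (n + k.+1)%N|by exists n].
  by rewrite natrD ns subrK.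
rewrite -ns !qseriesE // chr_dimE; congr (_ - _); case: ltnP => kn.
  by rewrite -natrB // qseriesE.
rewrite qseries_out // => m /eqP; rewrite eq_sym subr_eq -natrD eqr_nat; lia.
Qed.

End Character.

(** * A model of the Fock space, and the theorem *)

Definition ptn := {s : seq nat | sorted leq s}.
HB.instance Definition _ := Choice.on ptn.

(** Sorting selects one list for each multiset, so that multisets form a choice type and can index a
    basis. *)
Definition to_ptn (s : seq nat) : ptn :=
  exist _ (sort leq s) (sort_sorted leq_total s).

Section MalgFock.
Context {K : numFieldType}.
Local Notation F := {malg K[ptn]}.

Lemma to_ptnK (s : ptn) : to_ptn (val s) = s.
Proof. by apply: val_inj; rewrite /= sorted_sort ?(valP s) //; apply: leq_trans. Qed.

Lemma to_ptn_eq s s' : (to_ptn s == to_ptn s') = perm_eq s s'.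
Proof.
by rewrite -val_eqE /=; apply/eqP/idP => /(perm_sortP leq_total leq_trans anti_leq).
Qed.

Definition malg_lift (V : lmodType K) (g : seq nat -> V) (x : F) : V :=
  \sum_(s <- msupp x) x@_s *: g (val s).

Lemma malg_liftE (V : lmodType K) (g : seq nat -> V) (x : F) (d : {fset ptn}) :
  (msupp x `<=` d)%fset -> malg_lift g x = \sum_(s <- d) x@_s *: g (val s).
Proof.
move=> le_xd; rewrite /malg_lift; apply: (big_fset_incl _ le_xd) => w _ wx.
by rewrite (mcoeff_outdom wx) scale0r.
Qed.

Definition malg_fock : fockSpace K.
Proof.
apply: (@FockSpace K F (fun s => << to_ptn s >>) (fun s x => x@_(to_ptn s)) malg_lift).
- by move=> s s'; rewrite -to_ptn_eq => /eqP ->.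
- by move=> s a x y; rewrite mcoeffD mcoeffZ.
- by move=> s s' /=; rewrite mcoeffU eq_sym to_ptn_eq.
- by move=> x x0; apply/malgP => s; rewrite -(to_ptnK s) x0 mcoeff0.
- move=> A AD As x.
  have A0 : A 0 by rewrite -(addNr << to_ptn [::] >>) -scaleN1r; apply: AD.
  rewrite (monalgE x); elim/big_rec: _ => [//|s y _ Ay].
  have -> : << x@_s *g s >> = x@_s *: << to_ptn (val s) >> :> F; last exact: AD.
  by apply/malgP => u; rewrite to_ptnK mcoeffZ !mcoeffU mulrnAr mulr1.
- move=> V g a x z.
  pose d := (msupp x `|` msupp z `|` msupp (a *: x + z))%fset.
  rewrite (@malg_liftE _ _ x d) ?(@malg_liftE _ _ z d) ?(@malg_liftE _ _ _ d);
    [|by apply/fsubsetP=> w; rewrite !in_fsetU => ->; rewrite ?orbT..].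
  rewrite scaler_sumr -big_split /=; apply: eq_bigr => w _.
  by rewrite mcoeffD mcoeffZ scalerDl scalerA.
- move=> V g s gs; rewrite (@malg_liftE _ _ _ [fset to_ptn s]%fset) ?msuppU_le //.
  by rewrite big_seq_fset1 mcoeffUU scale1r; apply: gs; apply/permPl/perm_sort.
Qed.

End MalgFock.

Theorem corollary1 (R : realType) (m : R[i])
  (hm : exists k : nat, m = k%:R / 2%:R)
  (L : virModule R[i]) (hL : is_irr_verma_quotient 1 (m ^+ 2) L) :
  has_character L
    (qmul (qpow (m ^+ 2) - qpow ((m + 1) ^+ 2)) (qseries ps_phi)).
Proof.
case: hm hL => k ->; move=> [Lirr [f f_hom f_surj]].
have hw := @fock_hw R[i] malg_fock k%:R.
(* The vacuum at charge k = 2 m has weight k^2/4 = m^2, so M(1, m^2) maps to this Fock space. *)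
have hE : (k%:R ^+ 2 / 4%:R : R[i]) = (k%:R / 2%:R) ^+ 2.
  by rewrite expr_div_n -(natrX _ 2 2).
rewrite hE in hw; have [g g_hom g_v] := verma_universal hw.
exact: (@virr_character R[i] malg_fock k L Lirr f f_hom f_surj g g_hom g_v).
Qed.
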